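(* Let $G=\mathrm{SL}_{n+1}$ (type $A_n$), let $P=P_I\subset G$ be a minuscule (equivalently, maximal) parabolic subgroup containing $B$, let $w\in W^I$ with $w\neq 1$, and let $\widehat w=(w_1,\ldots,w_m)$ be a generalised reduced decomposition of $w$ obtained by Construction 1 for some ordering of the peaks of $Q_w$. Then $$W(G_{w_1,\widehat x},T_{w_1})=W(G_{w_1,w_1x_1},T_{w_1}),$$ and this group, viewed as a subgroup of $W$, is generated by simple reflections.
   Context: Groups. $G$ is a simply connected simple algebraic group of simply-laced type over an algebraically closed field, $T\subset B\subset G$ a maximal torus and a Borel subgroup, $R$ the root system with positive roots $R^+$ (roots of $B$) and simple roots $S=\{\alpha_1,\ldots,\alpha_n\}$, $W=N_G(T)/T$ the Weyl group with simple reflections $s_i=s_{\alpha_i}$, length $\ell$ and Bruhat order $\le$. For $J\subset S$, $P_J$ is the parabolic subgroup generated by $B$ and representatives of $s_\alpha$, $\alpha\in J$; $W_J=\langle s_\alpha:\alpha\in J\rangle$; $W^J=\{w\in W: w(\beta)\in R^+\ \forall\beta\in J\}$; $P^{\alpha}=P_{S\setminus\{\alpha\}}$. A simple root $\alpha$ is minuscule if the fundamental weight $\varpi_\alpha$ satisfies $\langle\varpi_\alpha,\beta^\vee\rangle\le 1$ for all $\beta\in R^+$; a minuscule parabolic subgroup is $P=P^\alpha$ with $\alpha$ minuscule. In type $A_n$ all simple roots are minuscule. Schubert varieties. For $w\in W$: $\mathrm{Supp}(w)$ is the set of simple roots whose reflections occur in a reduced decomposition of $w$; $G_w$ is the subgroup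 of $G$ generated by the root subgroups $U_{\pm\alpha}$, $\alpha\in\mathrm{Supp}(w)$; $I^w=\{\alpha\in S: w(\alpha)\in R^+\}$, $P^w=P_{I^w}$; $X(w)$ is the closure of $BwP^w/P^w$ in $G/P^w$; $I_w=\{\alpha\in S: s_\alpha w\le w \text{ in } W/W_{I^w}\}$ and $P_w=P_{I_w}$, which is the stabiliser of $X(w)$ in $G$. If $1\ne w\in W^I$ with $P=P_I$ maximal then $P^w=P$. Quiver. Fix a reduced decomposition $w=s_{i_1}\cdots s_{i_k}$ and put $\beta(j)=\alpha_{i_j}$. The successor of $i\in[1,k]$ is $s(i)=\min\{j>i:\beta(j)=\beta(i)\}$ if it exists. The quiver $Q_w$ has vertex set $[1,k]$ and an arrow $i\to j$ if $\langle\beta(j)^\vee,\beta(i)\rangle\ne0$ and $i<j<s(i)$ (only $i<j$ if $s(i)$ does not exist). Write $i\preceq_Q j$ for the partial order on vertices generated by $i\preceq_Q j$ whenever there is an arrow $i\to j$. Peaks are the minimal vertices for $\preceq_Q$. (For minuscule $w$ the quiver does not depend on the reduced decomposition.) Construction 1. Choose any ordering $(p_1,\ldots,p_m)$ of the set of peaks of $Q_w$. Define inductively $V_t$ as the set of vertices $v\notin V_1\cup\cdots\cup V_{t-1}$ such that $p_u\not\preceq_Q v$ for all $u>t$; let $w_t$ be the product of the $s_{\beta(v)}$, $v\in V_t$, in increasing order of $v$. Then $w=w_1\cdots w_m$ and $\ell(w)=\sum\ell(w_t)$; $\widehat w=(w_1,\ldots,w_m)$ is the generalised reduced decomposition obtained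 by Construction 1 for this ordering. The variety $\widehat X(\widehat w)$. Put $u_i=w_iw_{i+1}\cdots w_m$. One has $P^{w_i}\cap G_{w_i}\subset P_{u_{i+1}}$. Set $\widehat X(w_m)=X(w_m)$ and recursively $\widehat X(w_i,\ldots,w_m)=\overline{(P_{w_i}\cap G_{w_i})w_i(P^{w_i}\cap G_{w_i})}\times^{P^{w_i}\cap G_{w_i}}\widehat X(w_{i+1},\ldots,w_m)$ (closure in $G_{w_i}$), where $P_{u_{i+1}}$ acts on $\widehat X(w_{i+1},\ldots,w_m)$. There is a locally trivial fibration $\widehat f:\widehat X(\widehat w)\to X(w_1)\subset G/P^{w_1}$ with fibre $\widehat X(w_2,\ldots,w_m)$, and a birational morphism $\widehat\pi:\widehat X(\widehat w)\to X(w)\subset G/P$ induced by multiplication, which is an isomorphism above $Bwx$, where $x=P/P$. The group $P_w$ acts on $\widehat X(\widehat w)$ and $\widehat\pi$ is $P_w$-equivariant. The base point $\widehat x$ is the unique point with $\widehat\pi(\widehat x)=wx$; it satisfies $\widehat f(\widehat x)=w_1x_1$, where $x_1=P^{w_1}/P^{w_1}$. $\widehat X(\widehat w)$ is smooth if and only if all $X(w_i)$ are smooth, and then $G_{w_1}\subset P_w$, so $G_{w_1}$ acts on $\widehat X(\widehat w)$. In type $A_n$ smoothness always holds. Weyl groups. $T_{w_1}$ is the neutral component of $T\cap G_{w_1}$, a maximal torus of $G_{w_1}$. $G_{w_1,y}$ denotes the stabiliser in $G_{w_1}$ of a point $y$. For a closed subgroup $H\subset G_{w_1}$ containing $T_{w_1}$,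 $W(H,T_{w_1})=N_H(T_{w_1})/T_{w_1}$, viewed as a subgroup of $W$ via $W(G_{w_1},T_{w_1})\simeq W_{\mathrm{Supp}(w_1)}\subset W$. *)

(* Defs.v *)
From HB Require Import structures.
From mathcomp Require Import all_boot all_order all_fingroup all_algebra.
From mathcomp Require mpoly.
From mathcomp Require Import boolp classical_sets.
Set Implicit Arguments.
Unset Strict Implicit.
Unset Printing Implicit Defensive.
Import GRing.Theory.
Local Open Scope ring_scope.
Local Open Scope classical_set_scope.

(** * Root system and Weyl group of type A_n *)

(** The pair [(a, b)], with [a != b], stands for the root
    [epsilon_a - epsilon_b]. *)
Definition rootA n : Type := ('I_n.+1 * 'I_n.+1)%type.

Definition simple n (i : 'I_n) : rootA n := (widen_ord (leqnSn n) i, lift ord0 i).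

Definition oppr_root n (r : rootA n) : rootA n := (r.2, r.1).

Definition positive_root n (r : rootA n) : bool := (r.1 < r.2)%N.

(** [pairing r q] is [<r^vee, q>]. *)
Definition pairing n (r q : rootA n) : int :=
  (r.1 == q.1)%:Z - (r.1 == q.2)%:Z - (r.2 == q.1)%:Z + (r.2 == q.2)%:Z.

(** The Weyl group is ['S_n.+1], a permutation [w] corresponding to the class
    of [perm_mx w] in [N_G(T) / T].  The group law of ['S_n.+1] is composition
    from left to right, which makes [perm_mx] multiplicative; since [perm_mx w]
    sends the [j]-th vector of the standard basis of column vectors to the
    [w^-1 j]-th one, [w] acts on roots through [w^-1]. *)
Definition wroot n (w : 'S_n.+1) (r : rootA n) : rootA n :=
  ((w^-1)%g r.1, (w^-1)%g r.2).

Definition refl n (i : 'I_n) : 'S_n.+1 := tperm (simple i).1 (simple i).2.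

Definition word_prod n (s : seq 'I_n) : 'S_n.+1 := (\prod_(i <- s) refl i)%g.

Definition reduced_decomposition n (s : seq 'I_n) (w : 'S_n.+1) : Prop :=
  word_prod s = w /\ forall t, word_prod t = w -> (size s <= size t)%N.

Definition bruhat_le n (v w : 'S_n.+1) : Prop :=
  exists s t, [/\ reduced_decomposition s w, subseq t s & word_prod t = v].

(** [W_J] *)
Definition W_par n (J : {set 'I_n}) : {set 'S_n.+1} :=
  <<[set refl i | i in J]%SET>>%g.

(** [W^J] *)
Definition W_min n (J : {set 'I_n}) (w : 'S_n.+1) : bool :=
  [forall b in J, positive_root (wroot w (simple b))].

(** The Bruhat order of [W / W_J], on the cosets of [v] and [w]: comparison of
    the representatives in [W^J]. *)
Definition bruhat_le_mod n (J : {set 'I_n}) (v w : 'S_n.+1) : Prop :=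
  exists v' w', [/\ W_min J v' /\ W_min J w', v' \in (v *: W_par J)%g,
                    w' \in (w *: W_par J)%g & bruhat_le v' w'].

Definition Supp n (w : 'S_n.+1) : {set 'I_n} :=
  [set i | `[< exists2 s, reduced_decomposition s w & i \in s >]]%SET.

(** [I^w] *)
Definition I_up n (w : 'S_n.+1) : {set 'I_n} :=
  [set i | positive_root (wroot w (simple i))]%SET.

(** [I_w] *)
Definition I_low n (w : 'S_n.+1) : {set 'I_n} :=
  [set i | `[< bruhat_le_mod (I_up w) (refl i * w)%g w >]]%SET.

(** * The quiver of a word and Construction 1 *)

Section Quiver.
Variables (n : nat) (s : seq 'I_n).
Implicit Types i j v : 'I_(size s).

Definition beta v : 'I_n := tnth (in_tuple s) v.

Definition is_succ i j : bool :=
  [&& (i < j)%N, beta j == beta i &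
      [forall l : 'I_(size s), (i < l)%N && (beta l == beta i) ==> (j <= l)%N]].

Definition arrow : rel 'I_(size s) := fun i j =>
  [&& pairing (simple (beta j)) (simple (beta i)) != 0, (i < j)%N &
      [forall l, is_succ i l ==> (j < l)%N]].

Definition quiver_le : rel 'I_(size s) := connect arrow.

Definition peaks : {set 'I_(size s)} :=
  [set v | [forall u, quiver_le u v ==> (u == v)]]%SET.

Definition peak_ordering (ps : seq 'I_(size s)) : Prop :=
  uniq ps /\ ps =i peaks.

(** The sets [V_t, V_{t+1}, ...] when [used] is the union of the previous ones
    and [ps] lists the peaks [p_t, p_{t+1}, ...]. *)
Fixpoint blocks (used : {set 'I_(size s)}) (ps : seq 'I_(size s)) :
    seq {set 'I_(size s)} :=
  if ps is _ :: ps' then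
    let V := [set v | (v \notin used) && all (fun p => ~~ quiver_le p v) ps']%SET in
    V :: blocks (used :|: V)%SET ps'
  else [::].

Definition block_prod (V : {set 'I_(size s)}) : 'S_n.+1 :=
  (\prod_(v in V) refl (beta v))%g.

Definition construction1 (ps : seq 'I_(size s)) : seq 'S_n.+1 :=
  map block_prod (blocks finset.set0 ps).

End Quiver.

(** * The group SL_{n+1} and its subgroups

    Subgroups are subsets of the ring of matrices; a point [g H] of a quotient
    [G / H] is a subset as well. *)

Section Group.
Variables (k : closedFieldType) (n : nat).
Local Notation M := 'M[k]_n.+1.
Local Notation W := 'S_n.+1.
Implicit Types (A H F P : set M) (g : M) (w : W) (J : {set 'I_n}).

Definition SL : set M := [set g | \det g = 1].

Definition torus : set M := [set g | SL g /\ is_diag_mx g].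

Definition borel : set M :=
  [set g | SL g /\ forall i j : 'I_n.+1, (j < i)%N -> g i j = 0].

Definition root_subgroup (r : rootA n) : set M :=
  [set g | exists c : k, g = 1 + c *: delta_mx r.1 r.2].

(** [g] lies in [N_G(T)] and its class modulo [T] is [w]. *)
Definition represents w : set M :=
  [set g | SL g /\ exists d : 'rV[k]_n.+1, g = perm_mx w *m diag_mx d].

Inductive gen_subgroup A : M -> Prop :=
| gen_in g : A g -> gen_subgroup A g
| gen_1 : gen_subgroup A 1
| gen_mul g h : gen_subgroup A g -> gen_subgroup A h -> gen_subgroup A (g * h)
| gen_inv g : gen_subgroup A g -> gen_subgroup A g^-1.

Definition parabolic J : set M :=
  gen_subgroup [set g | borel g \/ exists2 i, i \in J & represents (refl i) g].

(** [P^w] *)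
Definition P_up w : set M := parabolic (I_up w).

(** [P_w] *)
Definition P_low w : set M := parabolic (I_low w).

(** [G_w] *)
Definition G_supp w : set M :=
  gen_subgroup [set g | exists2 i, i \in Supp w &
    root_subgroup (simple i) g \/ root_subgroup (oppr_root (simple i)) g].

Definition left_coset g H : set M := [set g * h | h in H].

Definition translate g A : set M := [set g * x | x in A].

(** The point [w H] of [G / H], for a subgroup [H] containing [T]. *)
Definition wpoint w H : set M :=
  [set g | exists x h, [/\ represents w x, H h & g = x * h]].

(** * Zariski topology *)

Definition zariski_closed F : Prop :=
  exists E : set (mpoly.mpoly (n.+1 * n.+1) k),
    F = [set g | forall p, E p -> mpoly.meval (fun i => mxvec g 0 i) p = 0].

Definition closure_in H A : set M :=
  [set g | H g /\ forall F, zariski_closed F -> A `<=` F -> F g].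

Definition zariski_connected A : Prop :=
  forall F1 F2, zariski_closed F1 -> zariski_closed F2 ->
    A `<=` F1 `|` F2 -> A `&` (F1 `&` F2) = set0 -> A `<=` F1 \/ A `<=` F2.

Definition neutral_component H : set M :=
  [set g | exists C : set M, [/\ C `<=` H, zariski_connected C, C 1 & C g]].

(** [G / H] has the quotient topology: a set of cosets is closed when its
    inverse image in [G] is. *)
Definition closed_mod H (D : set (set M)) : Prop :=
  exists2 F, zariski_closed F & [set g | SL g /\ D (left_coset g H)] = SL `&` F.

Definition closure_mod H (D : set (set M)) : set (set M) :=
  [set c | (exists2 g, SL g & c = left_coset g H) /\
           forall E, closed_mod H E -> D `<=` E -> E c].

(** [X(w)], in [G / P^w] *)
Definition schubert w : set (set M) :=
  closure_mod (P_up w)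
    [set c | exists b x, [/\ borel b, represents w x & c = left_coset (b * x) (P_up w)]].

(** * The variety [Xhat (w_1, ..., w_m)]

    A point is represented by the set of all sequences [g_1, ..., g_m] in its
    class; for [m = 1] these are the one-term sequences on the elements of a
    coset of [P^w]. *)

(** The closure of [(P_w /\ G_w) w (P^w /\ G_w)] in [G_w]. *)
Definition cell_closure w : set M :=
  closure_in (G_supp w)
    [set g | exists p x q, [/\ (P_low w `&` G_supp w) p,
       (represents w `&` G_supp w) x, (P_up w `&` G_supp w) q & g = p * x * q]].

(** The action of [p] in [P_{u_1}], [u_1 = w_1 ... w_m], on representatives:
    [p . [g, y] = [g', p' . y]] whenever [p g = g' p'] with [g'] in the closure
    of the cell of [w_1] and [p'] in [P_{u_2}].  This is the action for which
    multiplication [(g_1, ..., g_m) |-> g_1 ... g_m] is equivariant; an element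
    of [G_{w_1}] preserving the closure acts by multiplication on [g_1]. *)
Fixpoint act_seq (ws : seq W) (p : M) (x y : seq M) : Prop :=
  match ws, x, y with
  | w :: ws', g :: x', g' :: y' =>
      if ws' is [::] then [/\ x' = [::], y' = [::] & g' = p * g]
      else exists p', [/\ P_low (\prod_(v <- ws') v)%g p', p * g = g' * p',
                          cell_closure w g' & act_seq ws' p' x' y']
  | _, _, _ => False
  end.

Definition act_point (ws : seq W) (p : M) (X : set (seq M)) : set (seq M) :=
  [set y | exists2 x, X x & act_seq ws p x y].

(** The class [[g, y]] in the contracted product by [P^w /\ G_w], where
    [(g q, y)] is identified with [(g, q . y)]. *)
Definition contracted_class w (ws : seq W) g (y : set (seq M)) : set (seq M) :=
  [set z | exists q t, [/\ (P_up w `&` G_supp w) q, act_point ws q^-1 y t &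
                           z = g * q :: t]].

Fixpoint Xhat (ws : seq W) : set (set (seq M)) :=
  match ws with
  | [::] => set0
  | [:: w] => [set X | exists2 c, schubert w c & X = [set [:: x] | x in c]]
  | w :: ws' => [set X | exists g y, [/\ cell_closure w g, Xhat ws' y &
                                         X = contracted_class w ws' g y]]
  end.

(** [pihat : Xhat -> G / P], [[g_1, ..., g_m] |-> g_1 ... g_m P] *)
Definition pihat P (X : set (seq M)) : set M :=
  [set g | exists x h, [/\ X x, P h & g = (\prod_(y <- x) y) * h]].

Definition base_point (ws : seq W) P w (X : set (seq M)) : Prop :=
  Xhat ws X /\ pihat P X = wpoint w P.

(** * Stabilisers and their Weyl groups *)

(** The stabiliser in [G_{w_1}] of a point of [Xhat (w_1, ...)]. *)
Definition stab_Xhat w1 (ws : seq W) (X : set (seq M)) : set M :=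
  [set g | G_supp w1 g /\ act_point ws g X = X].

(** The stabiliser in [G_{w_1}] of a point of a quotient of [G]. *)
Definition stab_coset w1 (c : set M) : set M :=
  [set g | G_supp w1 g /\ translate g c = c].

(** [T_{w_1}] *)
Definition T_supp w1 : set M := neutral_component (torus `&` G_supp w1).

Definition normalises g A : Prop := [set g * t * g^-1 | t in A] = A.

(** [W(H, T1) = N_H(T1) / T1], as a subset of [W]. *)
Definition weyl_of H (T1 : set M) : set W :=
  [set u | exists g, [/\ H g, normalises g T1 & represents u g]].

End Group.

(* Main.v *)
Require Import Defs.
From mathcomp Require Import all_boot all_order all_fingroup all_algebra.
From mathcomp Require mpoly.
From mathcomp Require Import boolp classical_sets.
From mathcomp Require Import zify ring.
Set Implicit Arguments.
Unset Strict Implicit.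
Unset Printing Implicit Defensive.
Import (canonicals) mpoly.

(** Let [A] be the set of the [y] with [u y <= a]; it determines a minimal
    representative [u].  Reading a reduced word of [u] from the right adds boxes to a
    partition with boundary [A], and for vertices [p] and [v] of the quiver
    [p <= v] means that the box of [v] is weakly North-West of that of [p].  So the
    peaks are the corners of the partition, [V_1] is the largest rectangle at the
    corner [p_1] below no other corner, [w_1] exchanges two adjacent blocks of
    coordinates, and the cell closure of [w_1] is all of [G_{w_1}].

    The stabiliser of [w_1 x_1] in [G_{w_1}] fixes the point [wP], hence it remains
    to see that an element [p] of [P_u] fixing the image [buP] of a point [[g_1, y]]
    fixes [[g_1, y]].  The Schubert conditions on the image of [y] bound the ranks
    of the South-West corners of [g_1^-1 b u], and this forces [g_1^-1 b w_1] into
    [P_{u_2}].  Therefore [p g_1 = g_1 p'] with [p'] in [P_{u_2}] fixing the image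
    of [y], and by induction [p'] fixes [y]. *)

(** Heights serve twice: [ht a u c] counts the ones of the permutation matrix of [u] in the rows
    from [c] on and the columns up to [a], so one function records the boxes and gives the ranks
    bounded by Schubert conditions. Removing a rectangle changes heights only strictly between two
    cuts [lo] and [e], where the larger path is first flat and then as steep as possible; there the
    rank bounds follow from those at [lo] and [e]. The induction cannot stay with base points and
    elements of [G_{w_1}]: conjugation by [g_1] need not give an element of [G_{w_2}], and the image
    of [y] is only a translate of [u_2 P]. This is why [b] and [p] range over the whole group [P_u].
    For the other inclusion of stabilisers, the case [b = 1] places [g_1^-1 w_1] in [P_{u_2}], so
    the base point lies over [w_1 x_1]. Simple reflections suffice because the stabiliser of
    [w_1 x_1] in [G_{w_1}] is block lower triangular for two adjacent intervals of coordinates, and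
    its Weyl group consists of the permutations preserving both. *)

Lemma val_simple1 n (i : 'I_n) : (simple i).1 = i :> nat. Proof. by []. Qed.
Lemma val_simple2 n (i : 'I_n) : (simple i).2 = i.+1 :> nat. Proof. by []. Qed.

Opaque simple.

Section WeylGroup.
Local Open Scope group_scope.

(** * Boundary heights, areas, and words that add a box at each letter *)

Section Heights.
Variable n : nat.
Implicit Types (a x : nat) (u v w : 'S_n.+1) (i : 'I_n) (s t : seq 'I_n).

(** The cut [x] lies between the coordinates [x - 1] and [x]; as [x] varies,
    [ht a u x] traces the boundary path of the partition, [base a] being that of the
    empty partition (with truncated subtraction). *)
Definition ht a u x : nat := (\sum_(y < n.+1 | x <= y) (u y <= a : nat))%N.
Definition base a x : nat := a.+1 - x.
Definition area a u : nat := (\sum_(x < n.+1) ht a u x)%N.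

(** Minimality for the maximal parabolic at [a], see [W_minP]. Roots see [u] through [u^-1], which
    must increase on the values up to [a] and on those beyond; in terms of positions, [u] keeps the
    order of two positions with values on the same side. *)
Definition grass a u : Prop :=
  forall y z : 'I_n.+1, y < z -> (u y <= a) = (u z <= a) -> u y < u z.

Lemma ht_step a u (y : 'I_n.+1) : ht a u y = ((u y <= a) + ht a u y.+1)%N.
Proof.
rewrite /ht (bigD1 y) //=; congr addn.
by apply: eq_bigl => z; rewrite [in RHS]ltn_neqAle andbC eq_sym.
Qed.

Lemma ht_card a u (c : nat) :
  ht a u c = #|fun y : 'I_n.+1 => (c <= y) && (u y <= a)|.
Proof.
rewrite /ht -sum1_card big_mkcond [RHS]big_mkcond; apply: eq_bigr => y _.
by rewrite unfold_in /=; case: (c <= y); case: (u y <= a).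
Qed.

Lemma ht_out a u x : n < x -> ht a u x = 0%N.
Proof. by move=> nx; rewrite /ht big_pred0 // => y; have := ltn_ord y; lia. Qed.

Lemma ht_1 a x : a <= n -> ht a 1 x = base a x.
Proof.
move=> an; have [m] := ubnP (n.+1 - x); elim: m x => // m IH x hm.
case: (leqP x n) => xn; last by rewrite ht_out // /base; lia.
have := ht_step a 1 (Ordinal (xn : x < n.+1)); rewrite /= perm1 /= => ->.
rewrite IH; last lia.
rewrite /base; case: (leqP x a); lia.
Qed.

Lemma ht_0 a u : a <= n -> ht a u 0 = a.+1.
Proof.
move=> an; have := ht_1 0 an; rewrite /base subn0 => <-; rewrite /ht /=.
rewrite [RHS](reindex_inj (@perm_inj _ u)) /=.
by apply: eq_bigr => y _; rewrite perm1.
Qed.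

Lemma ht_antitone a u x : ht a u x.+1 <= ht a u x <= (ht a u x.+1).+1.
Proof.
case: (leqP x n) => xn; last by rewrite !ht_out //; lia.
have := ht_step a u (Ordinal (xn : x < n.+1)) => /= ->; case: (_ <= a); lia.
Qed.

Lemma ht_mono a u x d : ht a u (x + d) <= ht a u x <= ht a u (x + d) + d.
Proof.
elim: d => [|d IH]; rewrite ?addn0 ?leqnn // addnS.
have := ht_antitone a u (x + d); lia.
Qed.

Lemma ht_leq a u x y : x <= y -> ht a u y <= ht a u x <= ht a u y + (y - x).
Proof. by move=> xy; have := ht_mono a u x (y - x); rewrite subnKC. Qed.

Lemma refl_simple1 i : refl i (simple i).1 = (simple i).2.
Proof. exact: tpermL. Qed.
Lemma refl_simple2 i : refl i (simple i).2 = (simple i).1.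
Proof. exact: tpermR. Qed.

Lemma ht_refl_other a u i x : x != i.+1 -> ht a (refl i * u) x = ht a u x.
Proof.
move=> xi; rewrite /ht (reindex_inj (@perm_inj _ (refl i))) /=.
apply: eq_big => [y|y _]; last by rewrite permM tpermK.
rewrite /refl; case: tpermP => [->|->|//]; rewrite ?val_simple1 ?val_simple2; lia.
Qed.

Lemma ht_refl_same a u i :
  ht a (refl i * u) i.+1 = ((u (simple i).1 <= a) + ht a u i.+2)%N.
Proof.
have := ht_step a (refl i * u) (simple i).2.
rewrite permM refl_simple2 val_simple2 => ->; rewrite ht_refl_other //; lia.
Qed.

Lemma ht_cut a u i : ht a u i.+1 = ((u (simple i).2 <= a) + ht a u i.+2)%N.
Proof. by have := ht_step a u (simple i).2; rewrite val_simple2. Qed.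

Lemma ht_cut0 a u i : ht a u i = ((u (simple i).1 <= a) + ht a u i.+1)%N.
Proof. by have := ht_step a u (simple i).1; rewrite val_simple1. Qed.

(** [refl i * u] exchanges the values of [u] at the positions [i] and [i.+1], which moves the
    boundary at the cut [i.+1] only. The additive form avoids truncated subtraction. *)
Lemma area_refl a u i :
  (area a (refl i * u) + (u (simple i).2 <= a) = area a u + (u (simple i).1 <= a))%N.
Proof.
rewrite /area (bigD1 (simple i).2) //= [in RHS](bigD1 (simple i).2) //=.
rewrite val_simple2 ht_refl_same ht_cut.
suff -> : (\sum_(y < n.+1 | y != (simple i).2) ht a (refl i * u) y
         = \sum_(y < n.+1 | y != (simple i).2) ht a u y)%N.
  by move: (\sum_(y < n.+1 | y != _) _)%N (ht a u _) => B C; case: (u _ <= a); case: (u _ <= a) => /=; lia.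
by apply: eq_bigr => y hy; apply: ht_refl_other; move: hy; rewrite -val_eqE.
Qed.

Lemma word_cons i s : word_prod (i :: s) = refl i * word_prod s.
Proof. by rewrite /word_prod big_cons. Qed.
Lemma word_cat s t : word_prod (s ++ t) = word_prod s * word_prod t.
Proof. by rewrite /word_prod big_cat. Qed.
Lemma word_nil : word_prod [::] = 1 :> 'S_n.+1.
Proof. by rewrite /word_prod big_nil. Qed.

Lemma area_word a s : area a (word_prod s) <= area a 1 + size s.
Proof.
elim: s => [|i s IH]; first by rewrite word_nil addn0.
have := area_refl a (word_prod s) i; rewrite word_cons /=.
case: (_ <= a); case: (_ <= a); lia.
Qed.

(** Every letter of [s], read from the right, adds a box. *)
Definition good a s : Prop := (area a (word_prod s) = area a 1 + size s)%N.

Lemma good_cons a i s : good a (i :: s) ->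
  [/\ good a s, word_prod s (simple i).1 <= a & a < word_prod s (simple i).2].
Proof.
rewrite /good word_cons /= => h.
have := area_refl a (word_prod s) i; have := area_word a s; rewrite h.
by case: (leqP _ a) => h1; case: (leqP _ a) => h2; split=> //; lia.
Qed.

Lemma good_cat a s t : good a (s ++ t) -> good a t.
Proof. by elim: s => // i s IH /good_cons[] /IH. Qed.

(** The two exchanged positions are adjacent and have values on different sides, so no pair on the
    same side changes its order. *)
Lemma grass_refl a u i : u (simple i).1 <= a -> a < u (simple i).2 ->
  grass a (refl i * u) -> grass a u.
Proof.
move=> h1 h2 g y z yz e.
have := g (refl i y) (refl i z); rewrite !permM !tpermK; apply=> //.
move: e; rewrite /refl; move: yz; case: (tpermP _ _ y) => [->|->|/eqP + /eqP];
  case: (tpermP _ _ z) => [->|->|/eqP + /eqP];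
  rewrite -?val_eqE -?val_eqE -?val_eqE -?val_eqE /= ?val_simple1 ?val_simple2 => *; lia.
Qed.

Lemma grass_suffix a s t : good a (s ++ t) -> grass a (word_prod (s ++ t)) ->
  grass a (word_prod t).
Proof.
elim: s => //= i s IH /good_cons[g h1 h2]; rewrite word_cons.
by move=> /(grass_refl h1 h2); apply: IH.
Qed.

(** Every letter adds a box, and a letter [i] can do so only at the cut [i.+1]; hence heights count
    letters. *)
Lemma good_ht a s x : a <= n -> good a s ->
  ht a (word_prod s) x = (base a x + count (fun i => i.+1 == x) s)%N.
Proof.
move=> an; elim: s => [|i s IH]; first by rewrite word_nil addn0 ht_1.
move=> /good_cons[g h1 h2]; rewrite word_cons /=.
case: (eqVneq i.+1 x) => [xi|ne].
  move: (IH g); rewrite -xi ht_refl_same h1 ht_cut leqNgt h2 add0n => ->.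
  by rewrite addnCA.
by rewrite ht_refl_other 1?eq_sym // IH.
Qed.

End Heights.

(** * Descents, parabolic subgroups and minimal representatives *)

Section Weyl.
Variable n : nat.
Implicit Types (a x : nat) (u v w : 'S_n.+1) (i : 'I_n) (s t : seq 'I_n) (J : {set 'I_n}).

Lemma chain_lt (f : 'I_n.+1 -> nat) (p q : 'I_n.+1) : p <= q ->
  (forall i, p <= i < q -> f (simple i).1 < f (simple i).2) ->
  f p + (q - p) <= f q.
Proof.
have [m] := ubnP (q - p); elim: m q => // m IH q hm pq h.
case: (ltngtP p q) pq => // [pq|/val_inj ->] _; last by rewrite subnn addn0.
have qn : q.-1 < n by have := ltn_ord q; lia.
pose i := Ordinal qn.
have qE : q = (simple i).2 by apply: val_inj; rewrite /= val_simple2 /=; lia.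
have := h i; rewrite -qE /= => /(_ ltac:(lia)) hi.
have := IH (simple i).1; rewrite val_simple1 /= => /(_ ltac:(lia) ltac:(lia)).
move=> /(_ (fun j hj => h j ltac:(lia))); lia.
Qed.

(** The increase from [ord0] to [y] gives [y <= u y], and that from [y] to [ord_max] gives
    [u y <= y]. *)
Lemma no_descent u : (forall i, u (simple i).1 < u (simple i).2) -> u = 1.
Proof.
move=> h; apply/permP=> y; rewrite perm1; apply: val_inj => /=.
have h1 := chain_lt (f := fun z => u z) (p := ord0) (q := y) (leq0n _) (fun i _ => h i).
have h2 := chain_lt (f := fun z => u z) (p := y) (q := ord_max) (leq_ord _) (fun i _ => h i).
have := ltn_ord (u ord_max); have := ltn_ord y; move: h1 h2 => /=; lia.
Qed.

Lemma perm_neq u i : (u (simple i).1 == u (simple i).2 :> nat) = false.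
Proof.
apply/negbTE/eqP => /val_inj/perm_inj/(congr1 val) /=; rewrite val_simple1 val_simple2; lia.
Qed.

Lemma descentP u : u <> 1 -> exists i, u (simple i).2 < u (simple i).1.
Proof.
move=> u1; apply: contrapT => h; apply: u1; apply: no_descent => i.
by have := perm_neq u i; case: ltngtP => // hi _; case: h; exists i.
Qed.

Lemma descent_ind (P : 'S_n.+1 -> Prop) : P 1 ->
  (forall u i, u (simple i).2 < u (simple i).1 -> P (refl i * u) -> P u) ->
  forall u, P u.
Proof.
(* By [area_refl], removing a descent raises no area, and it lowers the one with [a] equal to
   [u (simple i).2]. *)
move=> P1 Ps u; pose M v := (\sum_(a < n.+1) area a v)%N.
have [m] := ubnP (M u); elim: m u => // m IH u hm.
case: (eqVneq u 1) => [->//|/eqP /descentP[i hi]].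
apply: (Ps _ i hi); apply: IH; move: hm; rewrite ltnS; apply: leq_trans.
rewrite /M (bigD1 (u (simple i).2)) //= [X in _ < X](bigD1 (u (simple i).2)) //=.
have le a : area a (refl i * u) <= area a u.
  by have := area_refl a u i; case: (leqP _ a); case: (leqP _ a); lia.
have := area_refl (u (simple i).2) u i; rewrite leqnn leqNgt hi /= => e.
by rewrite -addSn; apply: leq_add; [lia | apply: leq_sum].
Qed.

Lemma word_exists u : exists s, word_prod s = u.
Proof.
elim/descent_ind: u => [|u i _ [s hs]]; first by exists [::]; rewrite word_nil.
by exists (i :: s); rewrite word_cons hs mulgA tperm2 mul1g.
Qed.

Lemma reduced_exists u : exists s, reduced_decomposition s u.
Proof.
have [t ht] := word_exists u.
pose P m := `[< exists2 s, size s = m & word_prod s = u >].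
have exP : exists m, P m by exists (size t); apply/asboolP; exists t.
case: (ex_minnP exP) => m /asboolP[s hs hu] hm.
by exists s; split=> // s' hs'; rewrite hs; apply: hm; apply/asboolP; exists s'.
Qed.

(** For [i] outside [J], the generators permute the positions up to [i] among themselves. Conversely
    a descent [i] of such a [u] lies in [J], since otherwise [u] would keep [i] and [i.+1] on their
    sides of the cut; so it can be removed. *)
Lemma W_parP J u :
  reflect (forall i, i \notin J -> forall y : 'I_n.+1, (u y <= i) = (y <= i))
          (u \in W_par J).
Proof.
apply: (iffP idP) => [/gen_prodgP[m [c hc ->]] i iJ|].
  elim/big_ind: _ => [y|v w hv hw y|j _ y]; first by rewrite perm1.
    by rewrite permM hw hv.
  have /imsetP[l lJ ->] := hc j.
  have il : i != l by apply: contraNneq iJ => ->.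
  rewrite /refl; case: tpermP => [->|->|//]; rewrite ?val_simple1 ?val_simple2;
    move: il; rewrite -val_eqE /=; lia.
elim/descent_ind: u => [_|u i hi IH hu]; first exact: group1.
have iJ : i \in J.
  apply: contraLR hi => /hu h; have := h (simple i).1; have := h (simple i).2.
  rewrite val_simple1 val_simple2; lia.
have -> : u = refl i * (refl i * u) by rewrite mulgA tperm2 mul1g.
apply: groupM; first by apply: mem_gen; apply: imset_f.
apply: IH => j jJ y; rewrite permM hu //.
have ji : j != i by apply: contraNneq jJ => ->.
rewrite /refl; case: tpermP => [->|->|//]; rewrite ?val_simple1 ?val_simple2;
    move: ji; rewrite -val_eqE /=; lia.
Qed.

Lemma W_minP (a : 'I_n) u : W_min (~: [set a])%SET u <-> grass a u.
Proof.
rewrite /W_min /positive_root /wroot /=; split=> [/forall_inP h y z yz e|h].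
  rewrite ltnNge; apply/negP => zy.
  have := chain_lt (f := fun j => (u^-1 j)%g) zy; rewrite !permK => H.
  have aux i : u z <= i < u y -> i \in (~: [set a])%SET.
    rewrite !inE -val_eqE /= => hi; apply/eqP; lia.
  have := H (fun i hi => h i (aux i hi)); lia.
apply/forall_inP => b; rewrite !inE -val_eqE /= => ba.
set y := (u^-1 _)%g; set z := (u^-1 (simple b).2)%g.
have yE : u y = (simple b).1 by rewrite permKV.
have zE : u z = (simple b).2 by rewrite permKV.
case: (ltngtP y z) => // [zy|/val_inj yz].
  have := h z y zy; rewrite yE zE val_simple1 val_simple2; lia.
move: zE; rewrite -yz yE => /(congr1 val) /=; rewrite val_simple1 val_simple2; lia.
Qed.

(** Heights determine which positions have values up to [a]; monotonicity on each side then leaves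
    no descent to [u^-1 * v]. *)
Lemma grass_inj a u v : grass a u -> grass a v -> ht a u =1 ht a v -> u = v.
Proof.
move=> gu gv huv.
have side y : (u y <= a) = (v y <= a).
  have := ht_step a u y; have := ht_step a v y; rewrite !huv.
  by case: (_ <= a); case: (_ <= a) => //; lia.
suff : u^-1 * v = 1 by move=> /(canRL (mulKVg _)); rewrite mulg1.
apply: no_descent => i; rewrite !permM.
set y := (u^-1 _)%g; set z := (u^-1 (simple i).2)%g.
have yE : u y = (simple i).1 by rewrite permKV.
have zE : u z = (simple i).2 by rewrite permKV.
have := side y; have := side z; rewrite yE zE val_simple1 val_simple2.
case: (ltngtP y z) => [yz|zy|/val_inj yz] sz sy.
- by case: (eqVneq (v y <= a) (v z <= a)) => [|ne]; [exact: gv|lia].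
- have := gu z y zy; rewrite yE zE val_simple1 val_simple2 => h.
  by case: (eqVneq (v y <= a) (v z <= a)) => [|ne]; lia.
- move: zE; rewrite -yz yE => /(congr1 val) /=; rewrite val_simple1 val_simple2; lia.
Qed.

(** A descent of such a [u] involves both sides, so removing it removes a box. *)
Lemma good_exists a u : grass a u -> exists2 s, word_prod s = u & good a s.
Proof.
elim/descent_ind: u => [_|u i hi IH gu].
  by exists [::]; rewrite ?word_nil // /good word_nil addn0.
have [h1 h2] : u (simple i).2 <= a /\ a < u (simple i).1.
  have := gu (simple i).1 (simple i).2; rewrite val_simple1 val_simple2; lia.
have uE : refl i * (refl i * u) = u by rewrite mulgA tperm2 mul1g.
case: IH => [|s sE gs].
  by apply: (@grass_refl _ _ _ i); rewrite ?uE // permM ?refl_simple1 ?refl_simple2.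
exists (i :: s); first by rewrite word_cons sE.
have := area_refl a u i; move: gs; rewrite /good word_cons sE uE h1 leqNgt h2 /=.
lia.
Qed.

Lemma good_reduced a s : good a s -> reduced_decomposition s (word_prod s).
Proof.
move=> gs; split=> // t tE; have := area_word a t.
by rewrite tE gs leq_add2l.
Qed.

(** A reduced word is no longer than a good one, which turns the bound [area_word] into an
    equality. *)
Lemma reduced_good a u s : grass a u -> reduced_decomposition s u -> good a s.
Proof.
move=> /good_exists[t tE gt] [sE /(_ t tE) st]; apply/eqP.
rewrite eqn_leq area_word /= sE -tE gt; lia.
Qed.

Lemma grass_Supp a u i : a <= n -> grass a u ->
  (i \in Supp u) = (base a i.+1 < ht a u i.+1).
Proof.
move=> an gu; rewrite inE; apply/asboolP/idP => [[s hs si]|].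
  have gs := reduced_good gu hs; case: hs => <- _.
  rewrite good_ht // -[X in X < _]addn0 ltn_add2l -has_count.
  by apply/hasP; exists i.
have [s sE gs] := good_exists gu; rewrite -sE good_ht //.
rewrite -[X in X < _]addn0 ltn_add2l -has_count => /hasP[j js /eqP[ji]].
by exists s; [exact: good_reduced gs | rewrite -(val_inj ji)].
Qed.

(** If the simple root [a] stayed positive too, [u^-1] would have no descent and [u] would be
    [1]. *)
Lemma grass_I_up (a : 'I_n) u : grass a u -> u <> 1 -> I_up u = (~: [set a])%SET.
Proof.
move=> /W_minP /forall_inP h u1; apply/setP=> i; rewrite inE.
apply/idP/idP => [hi|]; last exact: h.
rewrite !inE; apply/eqP => ia; apply: u1.
rewrite -[u]invgK [u^-1]no_descent ?invg1 // => j.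
by case: (eqVneq j i) => [->//|ji]; apply: h; rewrite !inE -ia.
Qed.

Lemma ht_coset a u v : (forall y, (v y <= a) = (y <= a)) ->
  ht a (u * v) =1 ht a u.
Proof.
by move=> hv x; apply: eq_bigr => y _; rewrite permM hv.
Qed.

Lemma area_coset a u v : (forall y, (v y <= a) = (y <= a)) ->
  area a (u * v) = area a u.
Proof. by move=> hv; apply: eq_bigr => x _; exact: ht_coset. Qed.

(** The cuts of [P_u] are the places where a box can be added. *)
Definition addable a u i := (u (simple i).1 <= a) && (a < u (simple i).2).

(** Three cases for [refl i]. It adds a box: the larger area excludes the Bruhat relation. It
    removes one: deleting the first letter of a good word proves the relation. It concerns two
    values on the same side: [refl i * u] lies in the coset of [u]. *)
Lemma grass_I_low (a : 'I_n) u i : grass a u -> u <> 1 ->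
  (i \in I_low u) = ~~ addable a u i.
Proof.
move=> gu u1; rewrite inE (grass_I_up gu u1).
have par v : reflect (forall y, (v y <= a) = (y <= a)) (v \in W_par (~: [set a])).
  apply: (iffP (W_parP _ _)) => h; first by apply: h; rewrite !inE negbK.
  by move=> j; rewrite !inE negbK => /eqP ->.
apply/asboolP/idP => [[v [w [[gv gw]]]]|].
  rewrite !mem_lcoset => /par hv /par hw [s [t [sw ts tv]]].
  apply/negP => /andP[h1 h2].
  move/W_minP: gw => gw; have := reduced_good gw sw; case: (sw) => sE _.
  rewrite /good sE; have := area_word a t; rewrite tv.
  have := area_coset (refl i * u) hv; have := area_coset u hw.
  rewrite !mulKVg => -> ->; have := size_subseq ts.
  by have := area_refl a u i; rewrite h1 leqNgt h2 /=; lia.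
have coset1 w : w \in (w *: W_par (~: [set a]))%g.
  by rewrite mem_lcoset mulVg group1.
move=> hadd; case: (boolP (u (simple i).2 <= a < u (simple i).1)) => [/andP[h1 h2]|ns].
  have uE : refl i * (refl i * u) = u by rewrite mulgA tperm2 mul1g.
  have gu' : grass a (refl i * u).
    by apply: (@grass_refl _ _ _ i); rewrite ?uE // permM ?refl_simple1 ?refl_simple2.
  exists (refl i * u), u; split; rewrite ?coset1 //; first by split; apply/W_minP.
  have [s sE gs] := good_exists gu'.
  have g2 : good a (i :: s).
    move: gs; rewrite /good word_cons sE uE /=; have := area_refl a u i.
    rewrite h1 leqNgt h2 /=; lia.
  exists (i :: s), s; rewrite sE; split=> //; last exact: subseq_cons.
  by have := good_reduced g2; rewrite word_cons sE uE.
exists u, u; split; rewrite ?coset1 //; first by split; apply/W_minP.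
  rewrite mem_lcoset; apply/par => y; rewrite invMg tpermV permM permM.
  case: (boolP (y <= a)) => ya; move: hadd ns; rewrite /addable;
    have := permKV u y; set z := (u^-1 y)%g => zy; rewrite /refl;
    case: tpermP => [zE|zE|]; rewrite -?zE ?zy ?ya //; lia.
by have [s hs] := reduced_exists u; exists s, s; split=> //; case: hs.
Qed.

End Weyl.

(** Sorting by adjacent exchanges: a factor in [P] has to pass only the factors outside [P] that
    precede it, so commutation is asked for such pairs alone. *)
Lemma prod_partition (T : eqType) (gT : finGroupType) (lt : rel T) (P : pred T)
    (f : T -> gT) (l : seq T) :
  pairwise lt l ->
  (forall x y, x \in l -> y \in l -> lt x y -> ~~ P x -> P y ->
     f x * f y = f y * f x) ->
  \prod_(x <- l) f x =
  (\prod_(x <- l | P x) f x) * (\prod_(x <- l | ~~ P x) f x).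
Proof.
elim: l => [_ _|x l IH]; first by rewrite !big_nil mulg1.
rewrite pairwise_cons => /andP[/allP hx hl] hc; rewrite !big_cons IH //; last first.
  by move=> y z yl zl; apply: hc; rewrite inE ?yl ?zl orbT.
case: ifPn => Px; rewrite ?Px /=; first by rewrite mulgA.
rewrite !mulgA; congr (_ * _); rewrite big_seq_cond.
elim/big_rec: _ => [|y z /andP[yl Py] e]; first by rewrite mulg1 mul1g.
rewrite mulgA hc ?inE ?eqxx ?yl ?orbT //; first by rewrite -!mulgA e.
exact: hx.
Qed.

Lemma big_enum_ordered (T : finType) (gT : finGroupType) (A P : pred T) (f : T -> gT) :
  \prod_(x <- enum A | P x) f x = \prod_(x in A | P x) f x.
Proof. by rewrite [index_enum T]unlock -big_filter_cond. Qed.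

Lemma big_enum_ordered0 (T : finType) (gT : finGroupType) (A : pred T) (f : T -> gT) :
  \prod_(x <- enum A) f x = \prod_(x in A) f x.
Proof. by rewrite -[RHS]big_filter [index_enum T]unlock. Qed.

(** * Products over sets of vertices of the quiver *)

Section Quiver.
Variables (n : nat) (a : 'I_n) (s : seq 'I_n).
Implicit Types (u v p : 'I_(size s)) (F : {set 'I_(size s)}) (x l : nat)
  (ps : seq 'I_(size s)).
Local Notation b v := (beta v).+1.

Lemma block_prodE F : block_prod F = word_prod [seq beta v | v <- enum F].
Proof. by rewrite /block_prod /word_prod big_map big_enum_ordered0. Qed.

Lemma block_split F F' : F' \subset F ->
  (forall v' v, v' \in F' -> v \in F -> v \notin F' -> v' < v ->
     refl (beta v') * refl (beta v) = refl (beta v) * refl (beta v')) ->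
  block_prod F = block_prod (F :\: F') * block_prod F'.
Proof.
move=> sF hc; rewrite /block_prod.
have pw : pairwise (fun u v => u < v) (enum F).
  rewrite {1}/enum_mem -enumT; apply: pairwise_filter.
  rewrite -(pairwise_map val ltn) val_enum_ord -sorted_pairwise ?iota_ltn_sorted //.
  exact: ltn_trans.
have := prod_partition (P := fun v => v \notin F') (f := fun v => refl (beta v)) pw.
rewrite big_enum_ordered0 => ->; last first.
  move=> u v; rewrite !mem_enum negbK => uF vF uv uF' vF'; exact: hc.
rewrite !big_enum_ordered; congr (_ * _); apply: eq_bigl => v; rewrite ?inE ?negbK; first by rewrite andbC.
by case: (boolP (v \in F')) => [/(fintype.subsetP sF _) ->|]; rewrite ?andbF.
Qed.

Definition goodF F : Prop :=
  good a [seq beta v | v <- enum F] /\ grass a (block_prod F).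

(** Regrouping changes neither the product nor the number of letters, so the regrouped word still
    adds a box at each letter, and its final part inherits this. *)
Lemma goodF_split F F' : F' \subset F -> goodF F ->
  block_prod F = block_prod (F :\: F') * block_prod F' ->
  good a ([seq beta v | v <- enum (F :\: F')] ++ [seq beta v | v <- enum F']) /\
  goodF F'.
Proof.
move=> sF [gF grF] e.
have g : good a ([seq beta v | v <- enum (F :\: F')] ++ [seq beta v | v <- enum F']).
  move: gF; rewrite /good word_cat -!block_prodE -e size_cat !size_map -!cardE => ->.
  by rewrite -(cardsID F' F) (finset.setIidPr sF) [X in (_ + X)%N = _]addnC.
split=> //; split; first exact: good_cat g.
rewrite block_prodE; apply: grass_suffix g _.
by rewrite word_cat -!block_prodE -e.
Qed.

(** The boundary path predicted by counting the boxes of [F]; it is the actual path of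
    [block_prod F] when [goodF a F] holds. *)
Definition htF F x := (base a x + #|[set v in F | b v == x]|)%N.

Lemma goodF_ht F x : goodF F -> ht a (block_prod F) x = htF F x.
Proof.
case=> gF _; rewrite block_prodE good_ht //; last exact/ltnW/ltn_ord.
by rewrite count_map -sum1_count big_enum_cond sum1dep_card.
Qed.

End Quiver.

(** * Vertices as boxes of the partition *)

Section Boxes.
Variables (n : nat) (a : 'I_n) (s : seq 'I_n).
Hypothesis gT : goodF a [set: 'I_(size s)].
Implicit Types (u v p : 'I_(size s)) (F : {set 'I_(size s)}) (x l : nat)
  (ps : seq 'I_(size s)).
Local Notation b v := (beta v).+1.

Definition after v := [set w : 'I_(size s) | v < w]%SET.
(** Row of the box added by [v], counted from 1; a column is shifted by a constant
    in [box_col]. *)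
Definition box_row v := (htF a (after v) (b v)).+1.

Lemma goodF_ge v : goodF a [set w : 'I_(size s) | v <= w]%SET.
Proof.
have sF := finset.subsetT [set w : 'I_(size s) | v <= w]%SET.
apply: (proj2 (goodF_split sF gT _)); apply: block_split => // v' w.
by rewrite !inE => h1 _ h2 h3; lia.
Qed.

Lemma after_split v :
  good a (beta v :: [seq beta w | w <- enum (after v)]) /\ goodF a (after v).
Proof.
have sF : after v \subset [set w : 'I_(size s) | v <= w]%SET.
  by apply/fintype.subsetP => w; rewrite !inE; exact: ltnW.
have := goodF_split sF (goodF_ge v) (block_split sF _).
have -> : ([set w : 'I_(size s) | v <= w] :\: after v)%SET = [set v]%SET.
  apply/setP => w; rewrite !inE -val_eqE /=; lia.
rewrite enum_set1 /=; apply=> v' w; rewrite !inE => h1 h2 h3; lia.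
Qed.

(** A box is added at an inner corner of the boundary: just before, the path descends right before
    the cut [b v] and is flat right after it. *)
Lemma level_nbr v :
  htF a (after v) (beta v) = box_row v /\ (htF a (after v) (b v).+1).+1 = box_row v.
Proof.
have [/good_cons[_]] := after_split v; rewrite -block_prodE /box_row => h1 h2 gA.
rewrite -!goodF_ht // ht_cut0 h1 ht_cut leqNgt h2; split=> //=.
Qed.

Lemma htF_sub F F' x : F \subset F' -> htF a F x <= htF a F' x.
Proof.
move=> /fintype.subsetP sF; rewrite leq_add2l subset_leq_card //.
by apply/fintype.subsetP => v; rewrite !inE => /andP[/sF -> ->].
Qed.

Lemma level_le u v : u < v -> box_row v <= htF a (after u) (b v).
Proof.
move=> uv; rewrite /box_row /htF -addnS leq_add2l.
have : v \notin [set w in after v | b w == b v]%SET by rewrite !inE ltnn.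
move=> vn; have := cardsU1 v [set w in after v | b w == b v]%SET.
rewrite vn add1n => <-; apply: subset_leq_card; apply/fintype.subsetP => w.
rewrite !inE => /orP[/eqP->|/andP[vw ->]]; first by rewrite uv eqxx.
by rewrite (ltn_trans uv vw).
Qed.

Lemma level_lt u v : u < v -> beta u = beta v -> box_row v < box_row u.
Proof. by move=> uv e; rewrite ltnS e; exact: level_le. Qed.

Lemma level_inj u v : beta u = beta v -> box_row u = box_row v -> u = v.
Proof.
move=> e h; case: (ltngtP u v) => [|/[!ltnNge]|/val_inj//].
  by move=> /level_lt/(_ e); rewrite h ltnn.
by move=> /negP vu; have := @level_lt v u; rewrite e h ltnn ltnNge; case: leqP vu => // _ _ /(_ isT erefl).
Qed.

Lemma level_base v : base a (b v) < box_row v.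
Proof. by rewrite ltnS leq_addr. Qed.

Definition box_col v := (box_row v + beta v)%N.

(** Words are read from the right, so the box of [v] is present when that of [u] is added. Around
    the inner corner filled by [u], the boxes present on its diagonal and on the two neighbouring
    ones are weakly North-West of it. *)
Lemma box_adj u v : u < v -> beta u <= (beta v).+1 -> beta v <= (beta u).+1 ->
  box_row v <= box_row u /\ box_col v <= box_col u.
Proof.
move=> uv h1 h2; have := level_le uv; have [] := level_nbr u; rewrite /box_col.
have : [\/ beta v = beta u :> nat, beta v = (beta u).+1 :> nat | (beta v).+1 = beta u :> nat].
  case: (ltngtP (beta u) (beta v)) => h; [constructor 2|constructor 3|constructor 1]; lia.
have lu : box_row u = (htF a (after u) (b u)).+1 by [].
by case=> e; rewrite e; lia.
Qed.

End Boxes.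

Lemma pairing_simple n (p q : 'I_n) :
  (pairing (simple p) (simple q) != 0%R) = (p <= q.+1) && (q <= p.+1).
Proof.
rewrite /pairing -!val_eqE /= !val_simple1 !val_simple2.
lia.
Qed.

Lemma refl_commute n (p q : 'I_n) : ~~ ((p <= q.+1) && (q <= p.+1)) ->
  refl p * refl q = refl q * refl p.
Proof.
move=> pq; rewrite conjgC; congr (_ * _); rewrite /refl tpermJ.
by congr tperm; rewrite tpermD //; rewrite -val_eqE /= ?val_simple1 ?val_simple2; lia.
Qed.

Lemma connect_ind (T : finType) (e : rel T) (Q : T -> T -> Prop) :
  (forall x, Q x x) -> (forall x y z, e x y -> Q y z -> Q x z) ->
  forall x y, connect e x y -> Q x y.
Proof.
move=> Q0 Qs x y /connectP[p]; elim: p x => [|z p IH] x /=; first by move=> _ ->.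
by move=> /andP[xz zp] yE; apply: Qs xz _; apply: IH.
Qed.

(** * The quiver order is the order of boxes *)

Section Order.
Variables (n : nat) (a : 'I_n) (s : seq 'I_n).
Hypothesis gT : goodF a [set: 'I_(size s)].
Implicit Types (u v w p : 'I_(size s)) (F : {set 'I_(size s)}) (x l : nat)
  (ps : seq 'I_(size s)).
Local Notation b v := (beta v).+1.
Local Notation level := (box_row a).
Local Notation col := (box_col a).

Lemma quiver_le_box u v : quiver_le u v -> level v <= level u /\ col v <= col u.
Proof.
elim/connect_ind => // x y z /and3P[].
rewrite pairing_simple => /andP[h1 h2] xy _ [l1 l2].
have [] := box_adj gT xy; lia.
Qed.

Lemma quiver_le_pos u v : quiver_le u v -> u <= v.
Proof. by elim/connect_ind => // x y z /and3P[_ xy _]; apply: leq_trans (ltnW xy). Qed.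

Lemma level_le_htF F v :
  (forall u v, u \in F -> u < v -> beta u = beta v -> v \in F) ->
  v \in F -> level v <= htF a F (b v).
Proof.
move=> cF vF; rewrite /box_row /htF -addnS leq_add2l.
have : v \notin [set w in after v | b w == b v]%SET by rewrite !inE ltnn.
move=> vn; have := cardsU1 v [set w in after v | b w == b v]%SET.
rewrite vn add1n => <-; apply: subset_leq_card; apply/fintype.subsetP => w.
rewrite !inE => /orP[/eqP->|/andP[vw /eqP[/val_inj bw]]]; first by rewrite vF eqxx.
by rewrite (cF v w) ?bw ?eqxx.
Qed.

(** Pigeonhole: the vertices of letter [i] in [F] have distinct rows, all within an interval having
    as many elements as there are such vertices. *)
Lemma level_onto F (i : 'I_n) l :
  (forall u v, u \in F -> u < v -> beta u = beta v -> v \in F) ->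
  base a i.+1 < l -> l <= htF a F i.+1 ->
  exists2 v, v \in F & beta v = i /\ level v = l.
Proof.
move=> cF l1 l2; pose D := [set v in F | b v == i.+1]%SET.
have inD v : v \in D -> beta v = i by rewrite inE => /andP[_ /eqP[/val_inj]].
have inF v : v \in D -> v \in F by rewrite inE => /andP[].
have levD v : v \in D -> level v \in iota (base a i.+1).+1 #|D|.
  move=> vD; have := level_base a v; have := level_le_htF cF (inF v vD).
  by rewrite mem_iota (inD v vD) addSn ltnS => -> ->.
have U : uniq [seq level v | v <- enum D].
  rewrite map_inj_in_uniq ?enum_uniq // => u v; rewrite !mem_enum => uD vD.
  by apply: level_inj; rewrite (inD u uD) (inD v vD).
have [||_ e] := uniq_min_size U (s2 := iota (base a i.+1).+1 #|D|).
- by move=> _ /mapP[v vD ->]; apply: levD; rewrite -mem_enum.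
- by rewrite size_iota size_map -cardE.
have : l \in iota (base a i.+1).+1 #|D| by rewrite mem_iota l1 addSn ltnS.
rewrite -e => /mapP[v]; rewrite mem_enum => vD ->.
by exists v; [exact: inF | rewrite (inD v vD)].
Qed.

Lemma arrowI u w : u < w -> beta w <= b u -> beta u <= b w ->
  beta u <> beta w ->
  (forall l : 'I_(size s), u < l -> beta l = beta u -> w < l) -> arrow u w.
Proof.
move=> uw h1 h2 ne h; rewrite /arrow pairing_simple h1 h2 uw /=.
by apply/forallP => l; apply/implyP => /and3P[ul /eqP e _]; exact: h.
Qed.

(** Walk from the box of [u] North while its row differs from that of [v], then West. The neighbour
    exists because [u] filled an inner corner. An arrow leads to it: a later vertex on the diagonal
    of [u] is strictly West or North of the neighbour, hence comes after it in the word. *)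
Lemma box_quiver_le u v : level v <= level u -> col v <= col u -> quiver_le u v.
Proof.
have [m] := ubnP (level u + col u); elim: m u => // m IH u hm lvu cvu.
case: (eqVneq u v) => [->|uv]; first exact: connect0.
have bv := level_base a v; have bu := level_base a u.
have [hn1 hn2] := level_nbr gT u.
have all_ht x : htF a (after u) x <= htF a [set: 'I_(size s)] x.
  exact/htF_sub/finset.subsetT.
have closed w w' : w \in [set: 'I_(size s)]%SET -> w < w' -> beta w = beta w' ->
  w' \in [set: 'I_(size s)]%SET by move=> *; rewrite inE.
have go (w : 'I_(size s)) : u < w -> beta w <= b u -> beta u <= b w ->
    beta u <> beta w -> level v <= level w -> col v <= col w ->
    level w + col w < level u + col u ->
    (forall l : 'I_(size s), u < l -> beta l = beta u -> w < l) -> quiver_le u v.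
  move=> h1 h2 h3 h4 h5 h6 h7 h8; apply: (connect_trans (y := w)).
    exact/connect1/arrowI.
  by apply: IH => //; lia.
have earlier (w w' : 'I_(size s)) : w < w' -> beta w' <= b w -> beta w <= b w' ->
  level w' <= level w /\ col w' <= col w by move=> *; exact: (box_adj gT).
rewrite /box_col in lvu cvu *.
case: (ltnP (level v) (level u)) => lt1.
  have bn : b u < n.
    rewrite ltn_neqAle ltn_ord andbT; apply/eqP => e.
    move: hn2; rewrite -goodF_ht; last by case: (after_split gT u).
    by rewrite ht_out ?e; move: bv lt1; rewrite /base; lia.
  (* The box to the North: one row less and one letter more leave [col] unchanged. *)
  have [||w _ [bw lw]] := @level_onto [set: 'I_(size s)]%SET (Ordinal bn) (level u - 1) closed.
  - by rewrite /= /base in bv bu *; lia.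
  - by have := all_ht (b u).+1 => /=; lia.
  have {}bw : beta w = b u :> nat by rewrite bw.
  have uw : u < w.
    case: (ltngtP u w) => // [wu|/val_inj e]; last by move: bw; rewrite e; lia.
    by have [||] := earlier _ _ wu; rewrite ?/box_col ?bw ?lw; lia.
  apply: (go w uw); rewrite ?bw ?lw /box_col ?bw ?lw //; try lia.
    by move=> /(congr1 val) /=; lia.
  move=> l ul bl; have ll := level_lt a ul (esym bl).
  case: (ltngtP w l) => // [lw'|/val_inj e].
    by have [||] := earlier _ _ lw'; rewrite ?/box_col ?bl ?bw ?lw; lia.
  by move: bw; rewrite e bl; lia.
have le : level v = level u by lia.
have ltb : beta v < beta u.
  rewrite ltn_neqAle; apply/andP; split; last lia.
  by apply: contraNneq uv => /val_inj e; apply/eqP/esym; exact: level_inj e le.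
have bn : (beta u).-1 < n by have := ltn_ord (beta u); lia.
(* The box to the West: same row, one letter less. *)
have [||w _ [bw lw]] := @level_onto [set: 'I_(size s)]%SET (Ordinal bn) (level u) closed.
- by rewrite /= /base in bv bu *; lia.
- by have := all_ht (beta u); rewrite hn1 -[(Ordinal bn).+1]/((beta u).-1.+1) prednK //; lia.
have {}bw : beta w = (beta u).-1 :> nat by rewrite bw.
have uw : u < w.
  case: (ltngtP u w) => // [wu|/val_inj e]; last by move: bw ltb; rewrite e; lia.
  by have [||] := earlier _ _ wu; rewrite ?/box_col ?bw ?lw; lia.
apply: (go w uw); rewrite ?bw ?lw /box_col ?bw ?lw //; try lia.
  by move=> /(congr1 val) /=; lia.
move=> l ul bl; have ll := level_lt a ul (esym bl).
case: (ltngtP w l) => // [lw'|/val_inj e].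
  by have [||] := earlier _ _ lw'; rewrite ?/box_col ?bl ?bw ?lw; lia.
by move: bw ltb; rewrite e bl; lia.
Qed.

Lemma peak_above v : exists2 p, p \in peaks s & quiver_le p v.
Proof.
have [m] := ubnP v; elim: m v => // m IH v hm.
case: (boolP (v \in peaks s)) => [vp|]; first by exists v => //; exact: connect0.
rewrite inE negb_forall => /existsP[u]; rewrite negb_imply => /andP[uv nuv].
have := quiver_le_pos uv; rewrite leq_eqVlt => /orP[/eqP/val_inj e|lt].
  by rewrite e eqxx in nuv.
have [|p pp pu] := IH u; first lia.
by exists p => //; exact: connect_trans uv.
Qed.

Lemma peakP p u : p \in peaks s -> level p <= level u -> col p <= col u -> u = p.
Proof.
rewrite inE => /forallP/(_ u)/implyP h h1 h2; apply/eqP/h; exact: box_quiver_le.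
Qed.

End Order.

(** * Filters generated by peaks, and the rectangle lost with one peak *)

Section Filters.
Variables (n : nat) (a : 'I_n) (s : seq 'I_n).
Hypothesis gT : goodF a [set: 'I_(size s)].
Implicit Types (u v w p q : 'I_(size s)) (F : {set 'I_(size s)}) (x l : nat)
  (ps : seq 'I_(size s)).
Local Notation b v := (beta v).+1.
Local Notation level := (box_row a).
Local Notation col := (box_col a).

Definition upper ps := [set v | has (fun p => quiver_le p v) ps]%SET.

Lemma upperP ps v : reflect (exists2 p, p \in ps & quiver_le p v) (v \in upper ps).
Proof. by rewrite inE; exact: hasP. Qed.

Lemma upper_le ps u v : u \in upper ps -> quiver_le u v -> v \in upper ps.
Proof.
by move=> /upperP[p pp pu] uv; apply/upperP; exists p => //; exact: connect_trans uv.
Qed.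

Lemma upper_later ps u v : u \in upper ps -> u < v -> beta u = beta v -> v \in upper ps.
Proof.
move=> uF uv e; apply: upper_le uF _; have := level_lt a uv e.
by move=> h; apply: (box_quiver_le gT); rewrite /box_col ?e ?leq_add2r ltnW.
Qed.

Lemma upper_cons p ps : upper ps \subset upper (p :: ps).
Proof. by apply/fintype.subsetP => v; rewrite !inE /= => ->; rewrite orbT. Qed.

(** Were the letters equal or neighbours, [v] would be North-West of [v'] and hence in the
    filter. *)
Lemma upper_commute ps v' v : v' \in upper ps -> v \notin upper ps -> v' < v ->
  refl (beta v') * refl (beta v) = refl (beta v) * refl (beta v').
Proof.
move=> v'F vF v'v; apply: refl_commute; apply: contra vF => /andP[h1 h2].
apply: upper_le v'F _; apply: (box_quiver_le gT); by have [] := box_adj gT v'v h1 h2.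
Qed.

Lemma upper_split ps F : upper ps \subset F ->
  block_prod F = block_prod (F :\: upper ps) * block_prod (upper ps).
Proof. by move=> sF; apply: block_split => // v' v v'F _; exact: upper_commute. Qed.

Lemma upper_good ps : goodF a (upper ps).
Proof.
have sF := finset.subsetT (upper ps).
exact: (proj2 (goodF_split sF gT (upper_split sF))).
Qed.

Lemma upper_ht ps x : ht a (block_prod (upper ps)) x = htF a (upper ps) x.
Proof. exact/goodF_ht/upper_good. Qed.

Lemma upper_vertex ps x l : 0 < x <= n -> base a x < l <= htF a (upper ps) x ->
  exists2 v, v \in upper ps & b v = x /\ level v = l.
Proof.
case: x => // x xn /andP[l1 l2].
have [v vF [bv lv]] := @level_onto _ _ _ (upper ps) (Ordinal xn) l (@upper_later ps) l1 l2.
by exists v => //; rewrite bv.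
Qed.

(** A larger height at one of the three cuts would produce a box other than [p] weakly South-East of
    it, which [peakP] excludes. *)
Lemma peak_corner ps p : p \in peaks s -> p \in upper ps ->
  [/\ htF a (upper ps) (b p) = level p, htF a (upper ps) (beta p) = level p
    & (htF a (upper ps) (b p).+1).+1 = level p].
Proof.
move=> pp pF; set h := htF a (upper ps).
have an : a <= n by rewrite ltnW.
have hE x : h x = ht a (block_prod (upper ps)) x by rewrite upper_ht.
have lp := level_base a p; rewrite /base in lp.
have max v : level p <= level v -> col p <= col v -> v = p by exact: peakP.
have hge : level p <= h (b p) by apply: level_le_htF pF; exact: upper_later.
have bn := ltn_ord (beta p).
have h1 : h (b p) = level p.
  apply/eqP; rewrite eqn_leq hge andbT leqNgt; apply/negP => lt.
  have [||v vF [bv lv]] := @upper_vertex ps (b p) (level p).+1; rewrite ?lt /base //; try lia.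
  case: bv => bv; have := max v; rewrite /box_col lv bv => /(_ ltac:(lia) ltac:(lia)) e.
  by move: lv; rewrite e; lia.
have := ht_antitone a (block_prod (upper ps)) (beta p); rewrite -!hE h1 => ha0.
have := ht_antitone a (block_prod (upper ps)) (b p); rewrite -!hE h1 => ha1.
split=> //.
- case: (leqP (h (beta p)) (level p)) => [|lt]; first by lia.
  case: (posnP (beta p)) => [b0|b0].
    by move: lt; rewrite hE b0 ht_0 //; lia.
  have [||v vF [bv lv]] := @upper_vertex ps (beta p) (level p).+1; rewrite ?lt /base //; try lia.
  have := max v; rewrite /box_col lv => /(_ ltac:(lia) ltac:(lia)) e.
  by move: lv; rewrite e; lia.
- case: (ltnP (h (b p).+1) (level p)) => [|lt]; first by lia.
  case: (ltnP (b p) n) => [b0|b0]; last first.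
    by move: lt; rewrite hE ht_out; lia.
  have [||v vF [bv lv]] := @upper_vertex ps (b p).+1 (level p); rewrite ?lt /base //; try lia.
  have := max v; rewrite /box_col lv => /(_ ltac:(lia) ltac:(lia)) e.
  by move: bv; rewrite e; lia.
Qed.

(** [h] and [h'] are the boundary paths before and after removal of a rectangle with
    [c - lo] columns and [e - c] rows. *)
Record rect_heights (h h' : nat -> nat) (lo c e : nat) : Prop := RectHeights {
  rh_lo : lo < c;
  rh_e : c < e;
  rh_n : e <= n.+1;
  rh_flat : forall x, lo <= x <= c -> h x = h lo;
  rh_steep : forall x, c <= x <= e -> (h x + (x - c))%N = h lo;
  rh_before : 0 < lo -> h lo.-1 = (h lo).+1;
  rh_after : e <= n -> h e.+1 = h e;
  rh_out : forall x, (x <= lo) || (e <= x) -> h' x = h x;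
  rh_steep' : forall x, lo <= x <= lo + (e - c) -> (h' x + (x - lo))%N = h lo;
  rh_flat' : forall x, lo + (e - c) <= x <= e -> h' x = h e
}.

(** At the cut [c] of [p] a maximal flat run [[lo, c]] of the path meets a maximal steep run
    [[c, e]]. The flat run bounds the columns and the steep run the rows of the boxes that lie
    North-West of [p] and of no later peak. *)
Lemma peak_rect p ps : uniq (p :: ps) -> {subset p :: ps <= peaks s} ->
  exists lo c e, rect_heights (htF a (upper (p :: ps))) (htF a (upper ps)) lo c e.
Proof.
move=> U sub; set F := upper (p :: ps); set F' := upper ps.
set h := htF a F; set h' := htF a F'.
have an : a <= n by rewrite ltnW.
have hE x : h x = ht a (block_prod F) x by rewrite upper_ht.
have hE' x : h' x = ht a (block_prod F') x by rewrite upper_ht.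
have hle x y : x <= y -> h y <= h x <= h y + (y - x).
  by rewrite !hE; exact: ht_leq.
have hbase x : base a x <= h x by exact: leq_addr.
have inF q : q \in p :: ps -> q \in F by move=> qp; apply/upperP; exists q => //; exact: connect0.
have corner q : q \in p :: ps -> [/\ h (b q) = level q, h (beta q) = level q
    & (h (b q).+1).+1 = level q] by move=> qp; apply: peak_corner; [exact: sub|exact: inF].
have ptop : p \in p :: ps by rewrite inE eqxx.
have [hc hc0 hc1] := corner p ptop.
have bn := ltn_ord (beta p).
set c := b p in hc hc1 bn *; set H0 := level p in hc hc0 hc1 *.
have exlo : exists x, h x == H0 by exists c; apply/eqP.
case: (ex_minnP exlo) => lo /eqP hlo minlo.
have loc : lo < c by apply: minlo; rewrite hc0.
pose Pe x := (c < x <= n.+1) && (h x + (x - c) == H0)%N.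
have exe : exists x, Pe x.
  by exists c.+1; rewrite /Pe ltnSn /= -hc1 subSnn addn1 eqxx andbT.
have [|e /andP[/andP[ce en] /eqP he] maxe] := ex_maxnP exe (m := n.+1).
  by move=> x /andP[/andP[]].
have hn1 : h n.+1 = 0 by rewrite hE ht_out.
have h00 : h 0 = a.+1 by rewrite hE ht_0.
have lo0 : 0 < lo -> h lo.-1 = H0.+1.
  move=> l0; have := hle lo.-1 lo; have := minlo lo.-1; case: eqP => [_ /(_ isT)|ne _]; lia.
have e1 : e <= n -> h e.+1 = h e.
  move=> en'; have := hle e e.+1; have := maxe e.+1; rewrite /Pe.
  case: eqP => [_ h1|ne _]; lia.
have flat x : lo <= x <= c -> h x = H0.
  by move=> /andP[x1 x2]; have := hle lo x x1; have := hle x c x2; lia.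
have steep x : c <= x <= e -> (h x + (x - c))%N = H0.
  by move=> /andP[x1 x2]; have := hle c x x1; have := hle x e x2; lia.
have sF : {subset F' <= F} by apply/fintype.subsetP; exact: upper_cons.
(* A corner cannot lie inside a run, so another peak sits before [lo], which bounds its column, or
   from [e] on, which bounds its row. *)
have other q : q \in ps -> (level q <= h e) || (level q + b q <= H0 + lo).
  move=> qps; have qp : q \in p :: ps by rewrite inE qps orbT.
  have [hq hq0 hq1] := corner q qp.
  have nqp : b q != c.
    apply: contraTneq U => -[/val_inj eb]; rewrite /= negb_and negbK.
    have -> : p = q; last by rewrite qps.
    by apply: (@level_inj _ a _ _ _ (esym eb)); rewrite -hq eb; exact: esym hc.
  case: (ltnP (b q) lo) => ql; first by have := hle (b q) lo; lia.
  case: (ltnP (b q) c) => qc; first by have := flat (b q); have := flat (b q).+1; lia.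
  case: (ltnP (b q) e) => qe; first by have := steep (b q); have := steep (beta q); lia.
  by have := hle e (b q) qe; lia.
have top v : v \in F -> v \notin F' -> quiver_le p v.
  move=> /upperP[q]; rewrite inE => /orP[/eqP->//|qps] qv /upperP[]; by exists q.
have mem v : v \in F -> (v \in F') = (level v <= h e) || (level v + b v <= H0 + lo).
  move=> vF; apply/idP/idP.
    move=> /upperP[q qps /(quiver_le_box gT)]; have := other q qps.
    by rewrite /box_col; lia.
  move=> cond; apply: contraT => vF'.
  have [lv cv] := quiver_le_box gT (top v vF vF'); rewrite -/H0 in lv.
  have lb := level_base a v; rewrite /base in lb.
  (* Such a [w] lies below a remaining peak, which brings [v] into [F']. It is the box of row [h e]
     just after the steep run, or the lowest box of the column just before the flat run. *)
  suff [w wF [lw cw np]] : exists2 w, w \in F &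
      [/\ level v <= level w, col v <= col w & ~ quiver_le p w].
    have wF' : w \in F' by apply: contraT => /(top w wF).
    by rewrite (upper_le wF') // in vF'; exact: (box_quiver_le gT).
  case: (leqP (level v) (h e)) cond => [le1 _|_ /= le2].
    have en' : e < n.
      rewrite ltnNge; apply/negP => ne; case: (eqVneq e n.+1) => [eE|ne'].
        by move: le1; rewrite eE hn1; lia.
      have := e1 ltac:(lia); have -> : e.+1 = n.+1 by lia.
      by rewrite hn1; lia.
    have [||w wF [bw lw]] := @upper_vertex (p :: ps) e.+1 (h e); first lia.
      by rewrite -/F -/h e1 ?(ltnW en') // leqnn andbT; have := hbase e; rewrite /base; lia.
    exists w => //; split; rewrite /box_col ?lw //.
      by move: cv; rewrite /box_col -/H0 /c in bw ce he *; lia.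
    by move=> /(quiver_le_box gT) []; rewrite /box_col lw -/H0 /c in ce he *; lia.
  have lo1 : 1 < lo.
    case: (posnP lo) => [l0|l0]; first by move: hlo; rewrite l0 h00; lia.
    case: (eqVneq lo 1%N) => [l1|]; last lia.
    by have := lo0 l0; rewrite l1 h00; lia.
  have [||w wF [bw lw]] := @upper_vertex (p :: ps) lo.-1 H0.+1; first lia.
    by rewrite -/F -/h lo0 ?leqnn ?andbT /base; lia.
  exists w => //; split; rewrite /box_col ?lw; try lia.
  by move=> /(quiver_le_box gT) []; rewrite lw -/H0; lia.
(* [h' x] is described by the levels up to it: those of the base, and those of boxes of [F] outside
   the rectangle. *)
have h'char x l : 0 < x <= n -> (l <= h' x) =
    (l <= base a x) || ((l <= h x) && ((l <= h e) || (l + x <= H0 + lo))).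
  move=> xn; case: (leqP l (base a x)) => [lb|lb] /=.
    by apply: (leq_trans lb); exact: leq_addr.
  apply/idP/idP => [l2|/andP[l2 cond]].
    have [|v vF' [bv lv]] := @upper_vertex ps x l xn; first by rewrite lb.
    have vF := sF v vF'; have := vF'; rewrite mem // lv bv => ->; rewrite andbT.
    by rewrite -lv -bv; apply: level_le_htF vF; exact: upper_later.
  have [|v vF [bv lv]] := @upper_vertex (p :: ps) x l xn; first by rewrite lb.
  rewrite -lv -bv; apply: level_le_htF; first exact: upper_later.
  by rewrite mem // lv bv.
have out x : (x <= lo) || (e <= x) -> h' x = h x.
  move=> xo; case: (posnP x) => [->|x0]; first by rewrite hE hE' !ht_0.
  case: (leqP x n) => xn; last by rewrite hE hE' !ht_out.
  have := h'char x (h x); have := h'char x (h x).+1; rewrite x0 xn ltnn leqnn.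
  have := hbase x; have := hle x lo; have := hle e x; lia.
have Hb : base a lo <= H0 by rewrite -hlo.
rewrite /base in Hb.
have st x : lo <= x <= lo + (e - c) -> (h' x + (x - lo))%N = H0.
  move=> /andP[x1 x2]; case: (eqVneq x lo) => [->|ne]; first by rewrite out ?leqnn //; lia.
  have := h'char x (H0 - (x - lo)); have := h'char x (H0 - (x - lo)).+1.
  have := hle lo x; rewrite /base; lia.
exists lo, c, e; split=> //; rewrite ?hlo //.
move=> x /andP[x1 x2]; case: (eqVneq x e) => [->|ne]; first by rewrite out ?leqnn ?orbT.
have := h'char x (h e); have := h'char x (h e).+1.
have := hle x e; rewrite /base; lia.
Qed.

End Filters.

(** * Exchanges of adjacent blocks *)

Section Rectangles.
Variables (n : nat) (a : 'I_n).
Implicit Types (u v w : 'S_n.+1) (ws : seq 'S_n.+1) (y z : 'I_n.+1).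

Definition swapn (lo c e y : nat) : nat :=
  if (lo <= y < c) then y + (e - c) else if c <= y < e then y - (c - lo) else y.

Lemma swap_perm lo c e : lo < c -> c < e -> e <= n.+1 ->
  exists t : 'S_n.+1, forall y, t y = swapn lo c e y :> nat.
Proof.
move=> h1 h2 h3.
have lt y : swapn lo c e y < n.+1.
  by have := ltn_ord y; rewrite /swapn; do 2?case: ifP; lia.
have inj : injective (fun y => Ordinal (lt y)).
  move=> y z /(congr1 val) /= yz; apply: val_inj => /=; move: yz; rewrite /swapn.
  by do !case: ifP; lia.
by exists (perm inj) => y; rewrite permE.
Qed.

Record rect w u (lo c e : nat) : Prop := Rect {
  rect_h : rect_heights n (ht a (w * u)) (ht a u) lo c e;
  rect_swap : forall y, w y = swapn lo c e y :> nat;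
  rect_grass1 : grass a (w * u);
  rect_grass2 : grass a u
}.

Lemma ht_side u y : (u y <= a) = (ht a u y.+1 < ht a u y).
Proof. by rewrite (ht_step a u y); case: (_ <= a); rewrite ?ltnn ?add0n //= ?leqnn ?ltnn. Qed.

Section Sides.
Variables (h h' : nat -> nat) (lo c e : nat).
Hypothesis r : rect_heights n h h' lo c e.

(** Through [ht_side], slopes tell the sides of values: for [w * u], [[lo, c)] goes beyond [a] and
    [[c, e)] does not. For [u] the arrangement is opposite, with the change at [lo + (e - c)]. *)
Lemma rect_side1 (y : nat) :
  [/\ lo <= y < c -> (h y.+1 < h y) = false,
      c <= y < e -> h y.+1 < h y,
      y.+1 = lo -> h y.+1 < h y &
      y <= n -> y = e -> (h y.+1 < h y) = false].
Proof.
case: r => lc ce en fl st bf af _ _ _; split=> [yy|yy|yl|yn ye].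
- by have := fl y; have := fl y.+1; lia.
- by have := st y; have := st y.+1; lia.
- by rewrite yl; have := bf; rewrite -yl /=; lia.
- by rewrite ye af ?ltnn // -ye.
Qed.

Lemma rect_side2 (y : nat) :
  [/\ lo <= y < lo + (e - c) -> h' y.+1 < h' y,
      lo + (e - c) <= y < e -> (h' y.+1 < h' y) = false &
      (y < lo) || (e <= y) -> (h' y.+1 < h' y) = (h y.+1 < h y)].
Proof.
case: r => lc ce en fl st bf af out st' fl'; split=> [yy|yy|yo].
- by have := st' y; have := st' y.+1; lia.
- by have := fl' y; have := fl' y.+1; lia.
- by rewrite !out //; lia.
Qed.

End Sides.

(** For the block exchange [t], the products [t * u2] and [u1] have the same positions on each side.
    Since [t] reverses only pairs on different sides, [t * u2] is minimal as well and [grass_inj]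
    applies. *)
Lemma heights_rect u1 u2 lo c e : grass a u1 -> grass a u2 ->
  rect_heights n (ht a u1) (ht a u2) lo c e -> rect (u1 * u2^-1) u2 lo c e.
Proof.
move=> g1 g2 r; case: (r) => lc ce en _ _ _ _ _ _ _.
have [t tE] := swap_perm lc ce en.
suff e12 : u1 = t * u2.
  by split; rewrite ?mulgKV // => y; rewrite e12 mulgK tE.
have side y : (u2 (t y) <= a) = (u1 y <= a).
  rewrite !ht_side tE; have [s1 s2 _ _] := rect_side1 r y.
  rewrite /swapn; case: ifP => y1.
    by rewrite s1 //; have [_ -> //] := rect_side2 r (y + (e - c)); lia.
  case: ifP => y2; last by have [_ _ -> //] := rect_side2 r y; lia.
  by rewrite s2 //; have [-> //] := rect_side2 r (y - (c - lo)); lia.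
apply: (grass_inj g1) => [y z yz|x].
  rewrite !permM => s12; have := g2 (t y) (t z); rewrite s12; apply=> //.
  rewrite !tE; move: s12; rewrite !side !ht_side.
  have [a1 a2 _ _] := rect_side1 r y; have [b1 b2 _ _] := rect_side1 r z.
  rewrite /swapn; do !case: ifP; lia.
by apply: eq_bigr => y _; rewrite permM side.
Qed.

Definition wprod ws : 'S_n.+1 := \prod_(v <- ws) v.

Lemma wprod_cons w ws : wprod (w :: ws) = w * wprod ws.
Proof. by rewrite /wprod big_cons. Qed.

Fixpoint chain ws : Prop :=
  if ws is w :: ws' then
    (exists lo c e, rect w (wprod ws') lo c e) /\ chain ws'
  else True.

End Rectangles.

(** * Construction 1 yields a chain of rectangles *)

Section Construction.
Variables (n : nat) (a : 'I_n) (s : seq 'I_n).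
Hypothesis gT : goodF a [set: 'I_(size s)].
Implicit Type ps : seq 'I_(size s).

(** At each stage the used vertices are those above none of the remaining peaks, so a block is the
    difference of two successive filters, to which [peak_rect] applies. *)
Lemma blocks_chain ps : uniq ps -> {subset ps <= peaks s} ->
  let ws := map (@block_prod n s) (blocks (~: upper ps)%SET ps) in
  chain a ws /\ wprod ws = block_prod (upper ps).
Proof.
elim: ps => [|p ps IH] U sub.
  by split; rewrite // /wprod big_nil /block_prod big_pred0 // => v; rewrite inE.
have [] := IH (proj2 (andP U)) _; first by move=> q qs; apply: sub; rewrite inE qs orbT.
rewrite /=.
set V := [set v | (v \notin ~: upper (p :: ps)) && all (fun q => ~~ quiver_le q v) ps]%SET.
set used := (_ :|: V)%SET.
have VE : V = (upper (p :: ps) :\: upper ps)%SET.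
  by apply/setP => v; rewrite !inE negbK -all_predC andbC.
have -> : used = (~: upper ps)%SET.
  apply/setP => v; rewrite /used VE finset.in_setU finset.in_setD !finset.in_setC.
  have /fintype.subsetP/(_ v) := upper_cons p ps.
  by case: (v \in upper ps); case: (v \in upper (p :: ps)) => //= /(_ isT).
move=> ch pr.
have e := upper_split gT (upper_cons p ps).
rewrite /= wprod_cons VE. move: (map _ _) ch pr => ws ch pr. split; last by rewrite pr -e. split=> //.
have [lo [c [en r]]] := peak_rect gT U sub.
exists lo, c, en; rewrite pr.
have -> : block_prod (upper (p :: ps) :\: upper ps) =
    block_prod (upper (p :: ps)) * (block_prod (upper ps))^-1 by rewrite e mulgK.
apply: heights_rect; [exact: proj2 (upper_good gT _)|exact: proj2 (upper_good gT _)|].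
case: r => *; split=> *; rewrite ?upper_ht //; auto.
Qed.

End Construction.

Lemma construction_chain n (a : 'I_n) (s : seq 'I_n) (w : 'S_n.+1)
    (ps : seq 'I_(size s)) :
  grass a w -> reduced_decomposition s w -> peak_ordering ps ->
  chain a (construction1 ps) /\ wprod (construction1 ps) = w.
Proof.
move=> gw sw [U psE].
have gs := reduced_good gw sw; case: (sw) => pw _.
have wE : block_prod [set: 'I_(size s)] = w.
  by rewrite -pw /word_prod (big_tnth _ _ s); apply: eq_bigl => v; rewrite inE.
have gT : goodF a [set: 'I_(size s)].
  split; last by rewrite wE.
  by rewrite enum_setT -enumT; have := map_tnth_enum (in_tuple s); rewrite /= => ->.
have uE : upper ps = [set: 'I_(size s)]%SET.
  apply/setP => v; rewrite [RHS]inE; apply/upperP.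
  by have [p pp pv] := peak_above v; exists p; rewrite ?psE.
have := blocks_chain gT U; rewrite uE finset.setCT wE; apply.
by move=> p; rewrite psE.
Qed.

End WeylGroup.

(** * Coordinate projectors, flag steps and representatives *)

Section Matrices.
Import GRing.Theory.
Local Open Scope ring_scope.
Variables (k : closedFieldType) (n : nat).
Local Notation M := 'M[k]_n.+1.
Implicit Types (g h x A B : M) (w : 'S_n.+1) (J : {set 'I_n}) (i j : 'I_n.+1).

(** Submatrices are expressed as products with such projectors, so that all matrices stay square of
    one size. *)
Definition dproj (S : pred 'I_n.+1) : M := diag_mx (\row_j (S j)%:R).
Definition from (c : nat) : pred 'I_n.+1 := fun i => (c <= i)%N.

Lemma dprojE S i j : dproj S i j = (S i && (i == j))%:R.
Proof. by rewrite !mxE mulrb; case: (i == j); rewrite ?andbT ?andbF. Qed.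

Lemma dprojl S A i j : (dproj S * A) i j = if S i then A i j else 0.
Proof. by rewrite -mulmxE mul_diag_mx !mxE; case: (S i); rewrite ?mul1r ?mul0r. Qed.

Lemma dprojr S A i j : (A * dproj S) i j = if S j then A i j else 0.
Proof. by rewrite -mulmxE mul_mx_diag !mxE; case: (S j); rewrite ?mulr1 ?mulr0. Qed.

Lemma dprojM S S' : dproj S * dproj S' = dproj (predI S S').
Proof. by apply/matrixP => i j; rewrite dprojl !dprojE /=; case: (S i). Qed.

Lemma dprojK S : dproj S * dproj S = dproj S.
Proof. by apply/matrixP => i j; rewrite dprojl !dprojE /=; case: (S i). Qed.

Lemma dprojC S : dproj S + dproj (predC S) = 1.
Proof.
apply/matrixP => i j; rewrite mxE !dprojE mxE /=.
by case: (S i) => /=; rewrite ?mulr0n ?addr0 ?add0r.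
Qed.

Lemma rank_dproj_le S : (\rank (dproj S) <= #|S|)%N.
Proof.
have -> : dproj S = \sum_(l in S) delta_mx l l.
  apply/matrixP => i j; rewrite summxE dprojE.
  case: (boolP (S i)) => Si /=; last first.
    rewrite big1 // => l lS; rewrite mxE; case: eqP => // e.
    by move: Si lS; rewrite e unfold_in => /negbTE ->.
  rewrite (bigD1 i) //= big1 ?addr0 ?mxE ?eqxx 1?eq_sym // => l /andP[_ li].
  by rewrite mxE eq_sym (negbTE li).
rewrite -sum1_card; elim/big_ind2: _ => [|A p B q hA hB|l _].
- by rewrite mxrank0.
- exact: leq_trans (mxrank_add A B) (leq_add hA hB).
- by rewrite mxrank_delta.
Qed.

(** The upper bounds for [S] and its complement add up to the rank of the identity, so both are
    attained. *)
Lemma rank_dproj S : \rank (dproj S) = #|S|.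
Proof.
apply/eqP; rewrite eqn_leq rank_dproj_le /=.
have h1 := rank_dproj_le (predC S).
have := mxrank_add (dproj S) (dproj (predC S)); rewrite dprojC mxrank1.
have e : (#|S| + #|predC S| = n.+1)%N by rewrite -[RHS](card_ord n.+1) -(cardC S).
by move=> h2; have h3 := leq_trans h2 (leq_add (leqnn _) h1); rewrite -(leq_add2r #|predC S|) e.
Qed.

Lemma SL_unit g : SL g -> g \is a GRing.unit.
Proof. by rewrite /SL /= => d; rewrite unitmxE d unitr1. Qed.

Lemma SL_mul g h : SL g -> SL h -> SL (g * h).
Proof. by rewrite /SL /= => d1 d2; rewrite det_mulmx d1 d2 mulr1. Qed.

Lemma SL_1 : SL (1 : M).
Proof. by rewrite /SL /= det1. Qed.

Lemma SL_inv g : SL g -> SL g^-1.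
Proof. by rewrite /SL /= => d; rewrite det_inv d invr1. Qed.

Lemma rowspace_eq A B : (\rank B <= \rank (A * B)%R)%N -> exists C, B = C * (A * B).
Proof.
move=> r; have s : ((A * B)%R <= B)%MS by exact: submxMl.
have := mxrank_leqif_sup s; case=> le e.
have : (B <= (A * B)%R)%MS by rewrite -e eqn_leq r le.
by case/submxP => C BE; exists C; exact: BE.
Qed.

(** [g] stabilises the span of the first [c] basis vectors. *)
Definition upto (c : nat) (g : M) : Prop :=
  forall i j, (j < c)%N -> (c <= i)%N -> g i j = 0.

Lemma uptoP c g : upto c g <-> dproj (from c) * g = dproj (from c) * g * dproj (from c).
Proof.
split=> [h|h i j jc ci].
  apply/matrixP => i j; rewrite dprojr !dprojl /from.
  case: (leqP c i) => ci; case: (leqP c j) => jc //=.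
  by rewrite h.
by move/matrixP/(_ i j): h; rewrite dprojr !dprojl /from ci leqNgt jc.
Qed.

Lemma upto_mul c g h : upto c g -> upto c h -> upto c (g * h).
Proof.
move=> /uptoP hg /uptoP hh; apply/uptoP; rewrite mulrA hg -!mulrA.
by congr (_ * _); congr (_ * _); rewrite hh mulrA.
Qed.

Lemma upto_1 c : upto c 1.
Proof. by move=> i j jc ci; rewrite mxE; case: eqP => // e; move: jc ci; rewrite e; lia. Qed.

(** For the projector [P] on the rows from [c] on, [P * g * P = P * g] has the rank of [P], so
    [P = C * (P * g)] for some [C]. Hence [P * g^-1 = C * P], as [P = C * (P * g * P)] also
    shows. *)
Lemma upto_inv c g : SL g -> upto c g -> upto c g^-1.
Proof.
move=> /SL_unit ug /uptoP hg; apply/uptoP; set P := dproj _ in hg *.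
have [|C e] := @rowspace_eq (P * g) P.
  by rewrite -hg mxrankMfree // row_free_unit.
have -> : P * g^-1 = C * P by rewrite {1}e -hg -!mulrA mulrV // mulr1.
by rewrite -mulrA dprojK.
Qed.

Definition inside (lo e : nat) : pred 'I_n.+1 := fun i => (lo <= i < e)%N.

(** [g] is the identity outside the diagonal block of [[lo, e)]. Equations with projectors pass to
    products and inverses at once. *)
Definition fixes (lo e : nat) (g : M) : Prop :=
  let Q := dproj (predC (inside lo e)) in Q * g = Q /\ g * Q = Q.

Lemma fixesP lo e g : fixes lo e g <->
  forall i j, ~~ (inside lo e i && inside lo e j) -> g i j = (i == j)%:R.
Proof.
split=> [[h1 h2] i j|h].
  rewrite negb_and => /orP[] hi.
    by move/matrixP/(_ i j): h1; rewrite dprojl dprojE /= hi.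
  move/matrixP/(_ i j): h2; rewrite dprojr dprojE /= hi => ->.
  by case: (eqVneq i j) => [->|]; rewrite ?hi ?andbT ?andbF.
split; apply/matrixP => i j; rewrite ?dprojl ?dprojr dprojE /=.
  by case: (boolP (inside lo e i)) => hi //=; rewrite h // negb_and hi.
case: (boolP (inside lo e j)) => hi /=.
  by case: (eqVneq i j) => [->|]; rewrite ?hi ?andbF.
rewrite h ?(negbTE hi) ?andbF //; case: (eqVneq i j) => [->|_]; rewrite ?hi ?andbF //.
Qed.

Lemma fixes_1 lo e : fixes lo e 1.
Proof. by split; rewrite ?mulr1 ?mul1r. Qed.

Lemma fixes_mul lo e g h : fixes lo e g -> fixes lo e h -> fixes lo e (g * h).
Proof. by move=> [g1 g2] [h1 h2]; split; [rewrite mulrA g1 h1|rewrite -mulrA h2 g2]. Qed.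

Lemma fixes_inv lo e g : SL g -> fixes lo e g -> fixes lo e g^-1.
Proof.
move=> /SL_unit ug [g1 g2]; split; first by rewrite -{1}g1 -mulrA mulrV ?mulr1.
by rewrite -{1}g2 mulrA mulVr ?mul1r.
Qed.

Lemma fixes_upto lo e c g : fixes lo e g -> (c <= lo)%N || (e <= c)%N -> upto c g.
Proof.
move=> /fixesP h hc i j jc ci; rewrite h /inside; last lia.
by case: eqP => // ij; move: jc ci; rewrite ij; lia.
Qed.

Lemma representsP w x : represents w x <->
  SL x /\ exists d : 'I_n.+1 -> k, forall i j, x i j = (w i == j)%:R * d j.
Proof.
split=> [[sx [d xE]]|[sx [d xE]]]; split=> //.
  by exists (fun j => d 0 j) => i j; rewrite xE mul_mx_diag !mxE.
by exists (\row_j d j); apply/matrixP => i j; rewrite mul_mx_diag !mxE xE.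
Qed.

Lemma represents_entries w x : represents w x -> exists d : 'I_n.+1 -> k,
  [/\ forall j, d j != 0, forall i j, x i j = (w i == j)%:R * d j,
      forall A i j, (A * x) i j = A i (w^-1%g j) * d j &
      forall A i j, (x^-1 * A) i j = (d i)^-1 * A (w^-1%g i) j].
Proof.
case/representsP => sx [d xE]; exists d.
have xA A i j : (x * A) i j = d (w i) * A (w i) j.
  rewrite mxE (bigD1 (w i)) //= big1 ?addr0 ?xE ?eqxx ?mul1r // => l li.
  by rewrite xE eq_sym (negbTE li) !mul0r.
have d0 j : d j != 0.
  apply/eqP => dj; have := xA x^-1 (w^-1%g j) j.
  rewrite permKV dj mul0r mulrV ?SL_unit // mxE.
  have := SL_unit sx; rewrite unitmxE => ux.
  have := xA x^-1 (w^-1%g j) (w^-1%g j).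
  by rewrite mulrV ?SL_unit // permKV dj mul0r mxE eqxx => /eqP; rewrite oner_eq0.
split=> // A i j.
  rewrite mxE (bigD1 (w^-1%g j)) //= big1 ?addr0 ?xE ?permKV ?eqxx ?mul1r // => l li.
  by rewrite xE; case: eqP => [e|]; rewrite ?mul0r ?mulr0 //; rewrite -e permK eqxx in li.
have := xA (x^-1 * A) (w^-1%g i) j; rewrite mulrA mulrV ?SL_unit // mul1r permKV => ->.
by rewrite mulKf.
Qed.

Lemma represents_mul w w' x x' :
  represents w x -> represents w' x' -> represents (w * w')%g (x * x').
Proof.
move=> rx rx'; have [d [_ xE _ _]] := represents_entries rx.
have [d' [_ _ AE _]] := represents_entries rx'.
case: rx rx' => sx _ [sx' _]; apply/representsP; split; first exact: SL_mul.
exists (fun j => d (w'^-1%g j) * d' j) => i j; rewrite AE xE permM mulrA.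
by rewrite [in RHS](can2_eq (permK w') (permKV w')).
Qed.

Lemma represents_1 : represents 1%g (1 : M).
Proof.
apply/representsP; split; first exact: SL_1.
by exists (fun _ => 1) => i j; rewrite mxE perm1 mulr1.
Qed.

Lemma represents_inv w x : represents w x -> represents w^-1%g x^-1.
Proof.
move=> rx; have [d [d0 _ _ AE]] := represents_entries rx.
case: rx => sx _; apply/representsP; split; first exact: SL_inv.
exists (fun j => (d (w j))^-1) => i j; have := AE 1 i j; rewrite mulr1 => ->.
by rewrite mxE mulrC; case: eqP => [<-|]; rewrite ?permKV ?mul0r.
Qed.

End Matrices.

(** * Parabolic subgroups as block triangular matrices, and the groups [G_w] *)

Section Subgroups.
Import GRing.Theory.
Local Open Scope ring_scope.
Variables (k : closedFieldType) (n : nat).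
Local Notation M := 'M[k]_n.+1.
Implicit Types (g h x A B : M) (w : 'S_n.+1) (J : {set 'I_n}) (i j : 'I_n.+1).

Lemma simple_neq (i : 'I_n) : (simple i).1 != (simple i).2.
Proof. by rewrite -val_eqE /= val_simple1 val_simple2; lia. Qed.

Definition transvection (p q : 'I_n.+1) (c : k) : M := 1 + c *: delta_mx p q.

Lemma transE p q c i j : transvection p q c i j = (i == j)%:R + c * ((i == p) && (j == q))%:R.
Proof. by rewrite !mxE. Qed.

Lemma trans_mul p q c A i j : (transvection p q c * A) i j = A i j + (i == p)%:R * c * A q j.
Proof.
rewrite /transvection mulrDl mul1r mxE -scalerAl mxE -mulmxE.
congr (_ + _); rewrite mxE (bigD1 q) //= big1 ?addr0; last first.
  by move=> l lq; rewrite mxE (negbTE lq) andbF mul0r.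
by rewrite mxE eqxx andbT mulrCA mulrA.
Qed.

Lemma SL_trans p q c : p != q -> SL (transvection p q c).
Proof.
move=> pq; rewrite /SL /=.
wlog lt : p q pq / (q < p)%N.
  move=> H; case: (ltngtP q p) => [qp|qp|/val_inj e]; first exact: H.
    rewrite -det_tr; have -> : (transvection p q c)^T = transvection q p c.
      by apply/matrixP => i j; rewrite mxE !transE andbC eq_sym.
    by apply: H; rewrite 1?eq_sym.
  by rewrite e eqxx in pq.
rewrite det_trig; last first.
  apply/is_trig_mxP => i j ij; rewrite transE.
  have -> : (i == j) = false by rewrite -val_eqE /=; lia.
  case: andP => [[/eqP ip /eqP jq]|_]; last by rewrite mulr0 addr0.
  by move: ij lt; rewrite ip jq; lia.
apply: big1 => i _; rewrite transE eqxx.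
case: andP => [[/eqP ip /eqP jq]|_]; last by rewrite mulr0 addr0.
by move: pq; rewrite -ip -jq eqxx.
Qed.

(** The usual [SL_2] representative of a simple reflection; as a product of root elements it lies in
    [G_w] whenever [i] is in the support of [w]. *)
Definition nmx (i : 'I_n) : M :=
  transvection (simple i).1 (simple i).2 1 * transvection (simple i).2 (simple i).1 (-1) *
  transvection (simple i).1 (simple i).2 1.

Lemma represents_nmx (i : 'I_n) : represents (refl i) (nmx i).
Proof.
have LR := simple_neq i.
apply/representsP; split.
  by rewrite /nmx; do 2?apply: SL_mul; apply: SL_trans; rewrite // eq_sym.
exists (fun j => if j == (simple i).1 then -1 else 1) => p q.
rewrite /nmx -mulrA !trans_mul !transE /refl.
move: LR; set L := (simple i).1; set R := (simple i).2 => LR.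
have LRf := negbTE LR; have RLf : (R == L) = false by rewrite eq_sym.
rewrite !(eq_sym _ q) ?eqxx ?RLf ?LRf.
case: tpermP => [->|->|/eqP/negbTE pL /eqP/negbTE pR].
- rewrite ?eqxx ?LRf; case: (eqVneq q L) => [->|qL].
    by rewrite ?LRf /=; ring.
  by case: (q == R); rewrite /=; ring.
- rewrite ?eqxx ?RLf; case: (eqVneq q L) => [->|qL].
    by rewrite ?LRf /=; ring.
  by case: (q == R); rewrite /=; ring.
- rewrite pL pR /=; case: (eqVneq q p) => [->|_]; rewrite ?pL /=; ring.
Qed.

Lemma represents_exists w : exists x : M, represents w x.
Proof.
have [s <-] := word_exists w; elim: s => [|i s [x rx]].
  by exists 1; rewrite word_nil; exact: represents_1.
by exists (nmx i * x); rewrite word_cons; exact: represents_mul (represents_nmx i) rx.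
Qed.

Definition block_upper J g : Prop :=
  SL g /\ forall i : 'I_n, i \notin J -> upto i.+1 g.

Lemma block_upper_mul J g h : block_upper J g -> block_upper J h -> block_upper J (g * h).
Proof.
move=> [s1 u1] [s2 u2]; split; first exact: SL_mul.
by move=> i iJ; apply: upto_mul; [exact: u1|exact: u2].
Qed.

Lemma block_upper_inv J g : block_upper J g -> block_upper J g^-1.
Proof. by move=> [s u]; split=> [|i iJ]; [exact: SL_inv|apply: upto_inv => //; exact: u]. Qed.

Lemma block_upper_refl J (i : 'I_n) g : i \in J -> represents (refl i) g -> block_upper J g.
Proof.
move=> iJ /representsP[sg [d gE]]; split=> // l lJ p q ql lp.
have li : l != i by apply: contraNneq lJ => ->.
rewrite gE /refl; case: eqP => [|_]; last by rewrite mul0r.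
move: li; rewrite -val_eqE /= => li; case: tpermP => [pE|pE|_ _] qE;
  by move: ql lp; rewrite -qE ?pE ?val_simple1 ?val_simple2; lia.
Qed.

Lemma parabolic_sub J g : parabolic J g -> block_upper J g.
Proof.
elim=> [x [[sx bx]|[i iJ rx]]| |x y _ bx _ hy|x _ bx].
- by split=> // i _ p q qi ip; apply: bx; lia.
- exact: block_upper_refl iJ rx.
- by split; [exact: SL_1|move=> i _; exact: upto_1].
- exact: block_upper_mul.
- exact: block_upper_inv.
Qed.

(* Gaussian elimination, column by column: below the diagonal, the lowest
   nonzero entry of the first bad column is pushed up by a simple reflection,
   which lies in J because g vanishes below the blocks. *)
Lemma parabolic_sup J g : block_upper J g -> parabolic J g.
Proof.
move=> bg.
have H : forall d m r, (n.+1 - m = d)%N -> (m <= n.+1)%N -> (m <= r <= n)%N || (m == n.+1) ->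
    forall g, block_upper J g ->
    (forall i j, (j < m)%N -> (j < i)%N -> g i j = 0) ->
    (forall i j, j = m :> nat -> (r < i)%N -> g i j = 0) -> parabolic J g.
  move=> {g bg}; elim=> [|d IHd] m.
    move=> r dm mn _ g [sg _] tri _; apply: gen_in; left; split=> // i j ji.
    by apply: tri => //; have := ltn_ord j; lia.
  elim=> [|r IHr] dm mn mr g bg tri low.
    apply: (IHd m.+1 n) => //; try lia.
    - move=> i j jm ji; case: (ltngtP j m) => [jm'|jm'|jm']; [exact: tri|lia|].
      by apply: low => //; lia.
    - by move=> i j _; have := ltn_ord i; lia.
  have mn' : (m <= n)%N by lia.
  case: (eqVneq m r.+1) => [mE|mr'].
    apply: (IHd m.+1 n) => //; try lia.
    - move=> i j jm ji; case: (ltngtP j m) => [jm'|jm'|jm']; [exact: tri|lia|].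
      by apply: low => //; lia.
    - by move=> i j _; have := ltn_ord i; lia.
  have rn : (r < n)%N by lia.
  pose q := Ordinal (mn' : (m < n.+1)%N); pose i := Ordinal rn.
  pose L := (simple i).1; pose R := (simple i).2.
  have LE : L = r :> nat by exact: val_simple1.
  have RE : R = r.+1 :> nat by exact: val_simple2.
  case: (eqVneq (g R q) 0) => [g0|g0].
    apply: (IHr dm mn ltac:(lia)) => //.
    move=> p j jm rp; case: (ltngtP p r.+1) => [|pr|pE]; [lia|exact: low|].
    have -> : p = R by apply: val_inj; rewrite /= RE.
    by have -> : j = q by apply: val_inj.
  have iJ : i \in J.
    apply: contraNT g0 => iJ; apply/eqP; apply: (proj2 bg i iJ) => /=; rewrite ?RE /=; lia.
  (* Row [R] clears the entry of row [L] in column [q]; exchanging the two rows then moves the zero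
     to row [R]. *)
  pose x := transvection L R (- (g L q / g R q)).
  pose s := nmx i.
  have rs : represents (refl i) s := represents_nmx i.
  have bx : borel x.
    split; first exact: SL_trans (simple_neq i).
    move=> p j jp; rewrite transE.
    have -> : (p == j) = false by rewrite -val_eqE /=; lia.
    case: andP => [[/eqP pE /eqP jE]|_]; last by rewrite mulr0 addr0.
    by move: jp; rewrite pE jE LE RE; lia.
  have Px : parabolic J x by apply: gen_in; left.
  have Ps : parabolic J s by apply: gen_in; right; exists i.
  have [f [_ sE _ _]] := represents_entries rs.
  have sAE A p j : (s * A) p j = f (refl i p) * A (refl i p) j.
    rewrite mxE (bigD1 (refl i p)) //= big1 ?addr0 ?sE ?eqxx ?mul1r // => l ll.
    by rewrite sE eq_sym (negbTE ll) !mul0r.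
  pose g2 := s * (x * g).
  have gE : g = x^-1 * (s^-1 * g2).
    by rewrite /g2 mulKr ?mulKr // SL_unit //; [case: bx|case: rs].
  have g2E p j : g2 p j = f (refl i p) * (g (refl i p) j +
      (refl i p == L)%:R * (- (g L q / g R q)) * g R j).
    by rewrite /g2 sAE trans_mul.
  rewrite gE; apply: gen_mul; first exact: gen_inv.
  apply: gen_mul; first exact: gen_inv.
  apply: (IHr dm mn ltac:(lia)).
  - by apply: block_upper_mul (block_upper_mul _ bg); exact: parabolic_sub.
  - move=> p j jm jp; rewrite g2E (tri R j) ?mulr0 ?addr0 //; last by rewrite RE; lia.
    rewrite tri ?mulr0 // /refl; case: tpermP => [_|_|//]; rewrite -/L -/R ?LE ?RE; lia.
  - move=> p j jm rp; rewrite g2E.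
    have -> : j = q by apply: val_inj.
    case: (eqVneq p R) => [->|pR].
      by rewrite /R refl_simple2 eqxx mul1r mulNr divfK // subrr mulr0.
    have pr : (r.+1 < p)%N.
      by move: pR; rewrite -val_eqE /= RE; lia.
    have -> : refl i p = p.
      by rewrite /refl tpermD // -/L -/R -val_eqE /= ?LE ?RE; lia.
    rewrite (low p) // add0r.
    have -> : (p == L) = false by rewrite -val_eqE /= LE; lia.
    by rewrite !mul0r mulr0.
apply: (H n.+1 0%N n) => //; try by rewrite ?leqnn.
by move=> i j _; have := ltn_ord i; lia.
Qed.

Lemma parabolicP J g : parabolic J g <-> block_upper J g.
Proof. by split; [exact: parabolic_sub|exact: parabolic_sup]. Qed.

Lemma G_supp_SL w g : G_supp w g -> SL g.
Proof.
elim=> [x [i _ [[c ->]|[c ->]]]| |x y _ sx _ sy|x _ sx].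
- exact: SL_trans (simple_neq i).
- by apply: SL_trans; rewrite eq_sym simple_neq.
- exact: SL_1.
- exact: SL_mul.
- exact: SL_inv.
Qed.

Lemma G_supp_fixes lo e w g :
  (forall i : 'I_n, i \in Supp w -> (lo <= i)%N && (i.+1 < e)%N) ->
  G_supp w g -> fixes lo e g.
Proof.
move=> hw; elim=> [x [i iw hx]| |x y _ sx _ sy|x hx fx].
- have [l1 l2] := andP (hw i iw); apply/fixesP => p q.
  case: hx => [[c ->]|[c ->]]; rewrite -/(transvection _ _ _) transE /inside => npq;
  case: andP => [[/eqP pE /eqP qE]|_]; rewrite ?mulr0 ?addr0 //;
  by move: npq; rewrite pE qE /= ?val_simple1 ?val_simple2; lia.
- exact: fixes_1.
- exact: fixes_mul.
- by apply: fixes_inv fx; exact: G_supp_SL hx.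
Qed.

Lemma G_supp_represents w v (s : seq 'I_n) :
  {subset s <= Supp w} -> word_prod s = v -> exists2 x : M, G_supp w x & represents v x.
Proof.
move=> sub <-; elim: s sub => [|i s IH] sub.
  by exists 1; [exact: gen_1|rewrite word_nil; exact: represents_1].
have [|x gx rx] := IH; first by move=> j js; apply: sub; rewrite inE js orbT.
exists (nmx i * x); last by rewrite word_cons; exact: represents_mul (represents_nmx i) rx.
have iw : i \in Supp w by apply: sub; rewrite inE eqxx.
apply: gen_mul gx; apply: gen_mul; first apply: gen_mul; apply: gen_in; exists i => //.
- by left; exists 1.
- by right; exists (-1).
- by left; exists 1.
Qed.

Lemma represents_supp w : exists2 x : M, G_supp w x & represents w x.
Proof.
have [s sw] := reduced_exists w; apply: (G_supp_represents (s := s)); last by case: sw.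
by move=> i si; rewrite inE; apply/asboolP; exists s.
Qed.

End Subgroups.

(** * The groups attached to one rectangle *)

Section RectangleGroups.
Import GRing.Theory.
Local Open Scope ring_scope.
Local Open Scope classical_set_scope.
Variables (k : closedFieldType) (n : nat).
Local Notation M := 'M[k]_n.+1.
Implicit Types (g h x A B : M) (u v w : 'S_n.+1) (J : {set 'I_n}).

Lemma P_lowP (a : 'I_n) u g : grass a u -> u <> 1%g ->
  (P_low u g <-> SL g /\ forall i : 'I_n, addable a u i -> upto i.+1 g).
Proof.
move=> gu u1; rewrite /P_low parabolicP /block_upper.
by split=> -[sg hg]; split=> // i hi; apply: hg; move: hi;
   rewrite (grass_I_low _ gu u1) negbK.
Qed.

Lemma P_upP (a : 'I_n) u g : grass a u -> u <> 1%g ->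
  (P_up u g <-> SL g /\ upto a.+1 g).
Proof.
move=> gu u1; rewrite /P_up (grass_I_up gu u1) parabolicP /block_upper.
split=> -[sg hg]; split=> //; first by apply: hg; rewrite !inE negbK.
by move=> i; rewrite !inE negbK => /eqP ->.
Qed.

Section OneRectangle.
Variables (a : 'I_n) (w u : 'S_n.+1) (lo c e : nat).
Hypothesis r : rect a w u lo c e.
Let mid := (lo + (e - c))%N.

Lemma rect_bounds : [/\ (lo < c)%N, (c < e)%N & (e <= n.+1)%N].
Proof. by case: (rect_h r). Qed.

Lemma rect_corner_subproof : (mid.-1 < n)%N.
Proof. by rewrite /mid; case: rect_bounds; lia. Qed.

(** [w] moves [[c, e)] onto [[lo, mid)], so it is minimal for the maximal parabolic of the simple
    root [mid.-1], in general different from [a]. *)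
Definition rect_corner : 'I_n := Ordinal rect_corner_subproof.

Lemma rect_cornerE : (rect_corner : nat).+1 = mid.
Proof. by rewrite /= /mid; case: rect_bounds; lia. Qed.

Lemma rect_swap_mid (y : 'I_n.+1) :
  (w y < mid)%N = ((y < lo) || (c <= y < e))%N.
Proof.
by rewrite (rect_swap r) /swapn /mid; case: rect_bounds; do !case: ifP; lia.
Qed.

Lemma rect_swap_corner (y : 'I_n.+1) :
  (w y <= rect_corner)%N = ((y < lo) || (c <= y < e))%N.
Proof. by rewrite -ltnS rect_cornerE rect_swap_mid. Qed.

Lemma rect_grass : grass rect_corner w.
Proof.
move=> y z yz; rewrite !rect_swap_corner !(rect_swap r) /swapn.
case: rect_bounds; do !case: ifP; lia.
Qed.

Lemma rect_neq1 : w <> 1%g.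
Proof.
case: rect_bounds => h1 h2 h3 w1; have lon : (lo < n.+1)%N by lia.
have := rect_swap r (Ordinal lon); rewrite w1 perm1 /swapn /=; case: ifP; lia.
Qed.

Lemma rect_mul_neq1 : (w * u)%g <> 1%g.
Proof.
case: rect_bounds => h1 h2 h3 u1; have lon : (lo < n.+1)%N by lia.
have cn : (c < n.+1)%N by lia.
have [s1 _ _ _] := rect_side1 (rect_h r) lo.
have [_ s2 _ _] := rect_side1 (rect_h r) c.
have := ht_side a (w * u)%g (Ordinal lon); have := ht_side a (w * u)%g (Ordinal cn).
by rewrite s1 ?s2 ?leqnn ?h1 ?h2 //= u1 !perm1 /=; lia.
Qed.

Lemma rect_ht (x : nat) : ht rect_corner w x =
  if (x <= lo)%N then (mid - x)%N else if (x <= c)%N then (e - c)%N else (e - x)%N.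
Proof.
case: rect_bounds => h1 h2 h3.
have [m] := ubnP (n.+1 - x); elim: m x => // m IH x hm.
case: (leqP x n) => xn; last first.
  by rewrite ht_out // /mid; do !case: ifP; lia.
have := ht_step rect_corner w (Ordinal (xn : (x < n.+1)%N)) => /= ->.
rewrite IH; last lia.
rewrite rect_swap_corner /= /mid.
by case: (leqP x lo); case: (leqP x c); case: (ltnP x lo); case: (ltnP x c);
  case: (leqP c x); case: (ltnP x e) => //=; lia.
Qed.

Lemma rect_Supp (i : 'I_n) : (i \in Supp w) = (lo <= i)%N && (i.+1 < e)%N.
Proof.
rewrite (grass_Supp _ _ rect_grass); last exact/ltnW.
rewrite rect_ht /base rect_cornerE /mid; case: rect_bounds; do !case: ifP; lia.
Qed.

Lemma rect_fixes g : G_supp w g -> fixes lo e g.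
Proof. by apply: G_supp_fixes => i; rewrite rect_Supp. Qed.

Lemma rect_P_up g : P_up w g <-> SL g /\ upto mid g.
Proof. by rewrite -rect_cornerE; apply: P_upP; [exact: rect_grass|exact: rect_neq1]. Qed.

(** Boxes can be added to [w] only at the cuts [lo] and [e], where [G_w] preserves the flag. *)
Lemma rect_G_supp_low g : G_supp w g -> P_low w g.
Proof.
move=> gg; apply/(P_lowP _ rect_grass rect_neq1); split; first exact: G_supp_SL gg.
move=> i; rewrite /addable [(_ < w _)%N]ltnNge !rect_swap_corner val_simple1 val_simple2 => hi.
apply: (fixes_upto (rect_fixes gg)); move: hi.
case: rect_bounds; lia.
Qed.

(** Since [G_w] lies in [P_w], the cell is already all of [G_w]: take the factors [g * x^-1], [x]
    and [1]. *)
Lemma rect_cell_closure g : cell_closure w g <-> G_supp w g.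
Proof.
split=> [[]//|gg]; split=> // F _; apply.
have [x gx rx] := represents_supp k w.
have gx' : G_supp w (g * x^-1) by apply: gen_mul gg _; exact: gen_inv.
exists (g * x^-1), x, 1; split.
- by split=> //; exact: rect_G_supp_low.
- by split.
- by split; [apply/rect_P_up; split; [exact: SL_1|exact: upto_1]|exact: gen_1].
- by rewrite mulr1 mulrVK // SL_unit //; case: rx.
Qed.

Lemma addable_ht v (i : 'I_n) : addable a v i =
  (ht a v i.+1 < ht a v i)%N && ~~ (ht a v i.+2 < ht a v i.+1)%N.
Proof. by rewrite /addable [(a < _)%N]ltnNge !ht_side val_simple1 val_simple2. Qed.

Lemma rect_addable1 (i : 'I_n) : addable a (w * u)%g i -> (i < lo)%N || (e <= i.+1)%N.
Proof.
rewrite addable_ht; case: rect_bounds.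
have := rect_side1 (rect_h r) i; have := rect_side1 (rect_h r) i.+1.
by case=> ? ? ? ? []; lia.
Qed.

Lemma rect_addable2 (i : 'I_n) : addable a u i -> i.+1 <> mid ->
  addable a (w * u)%g i /\ ((i < lo)%N || (e <= i.+1)%N).
Proof.
rewrite !addable_ht /mid; case: rect_bounds.
have := rect_side2 (rect_h r) i; have := rect_side2 (rect_h r) i.+1.
move=> [p1 p2 p3] [q1 q2 q3] lc ce en /andP[d1 d2] im.
have hi : ((i.+1 < lo) || (e <= i))%N by lia.
by split; [move: d1 d2; rewrite -p3 -?q3; lia | lia].
Qed.

Lemma rect_addable_mid : addable a u rect_corner.
Proof.
have cE := rect_cornerE; have [h1 h2 h3] := rect_bounds.
have [p1 _ _] := rect_side2 (rect_h r) rect_corner.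
have [_ p2 _] := rect_side2 (rect_h r) mid.
rewrite addable_ht; rewrite !cE in p1 *.
by rewrite p1 ?p2 //; move: cE; rewrite /mid; lia.
Qed.

(** [lo] and [e] are addable cuts of [w * u], or else the ends [0] and [n.+1], where the condition
    is void. *)
Lemma rect_low1 g : P_low (w * u)%g g -> [/\ SL g, upto lo g & upto e g].
Proof.
move/(P_lowP _ (rect_grass1 r) rect_mul_neq1) => -[sg hg]; split=> //.
  case: (posnP lo) => [l0|l0]; first by move=> i j; rewrite l0.
  have ln : (lo.-1 < n)%N by case: rect_bounds; lia.
  have := hg (Ordinal ln); rewrite /= prednK //; apply; rewrite addable_ht /= prednK //.
  have [_ _ + _] := rect_side1 (rect_h r) lo.-1; rewrite prednK // => ->  //.
  by have [-> //] := rect_side1 (rect_h r) lo; case: rect_bounds; lia.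
case: (leqP e n) => en; last by move=> i j _ ei; have := ltn_ord i; lia.
have ln : (e.-1 < n)%N by case: rect_bounds; lia.
have e0 : (0 < e)%N by case: rect_bounds; lia.
have := hg (Ordinal ln); rewrite /= prednK //; apply; rewrite addable_ht /= prednK //.
have [_ + _ _] := rect_side1 (rect_h r) e.-1; rewrite prednK // => -> //; last first.
  by case: rect_bounds; lia.
by have [_ _ _ -> //] := rect_side1 (rect_h r) e.
Qed.

Lemma rect_G_supp_low1 g : G_supp w g -> P_low (w * u)%g g.
Proof.
move=> gg; apply/(P_lowP _ (rect_grass1 r) rect_mul_neq1).
split=> [|i]; first exact: G_supp_SL gg.
by move/rect_addable1 => hi; apply: (fixes_upto (rect_fixes gg)).
Qed.

Section Next.
Hypothesis u1 : u <> 1%g.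

(** By [rect_addable2], [mid] is the only flag step of [P_u] that may be missing. The case [u = 1]
    must be kept apart: there [I^u] contains all simple roots, and addable cuts do not describe
    [P_u]. *)
Lemma rect_low2 g : P_low (w * u)%g g -> upto mid g -> P_low u g.
Proof.
move/(P_lowP _ (rect_grass1 r) rect_mul_neq1) => -[sg hg] mg.
apply/(P_lowP _ (rect_grass2 r) u1); split=> // i ai.
by case: (eqVneq i.+1 mid) => [->//|/eqP im]; apply: hg; have [] := rect_addable2 ai im.
Qed.

Lemma rect_low2_mid g : P_low u g -> upto mid g.
Proof.
move/(P_lowP _ (rect_grass2 r) u1) => -[_ hg].
by rewrite -rect_cornerE; apply: hg; exact: rect_addable_mid.
Qed.

Lemma rect_up_low2 g : G_supp w g -> (P_up w g <-> P_low u g).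
Proof.
move=> gg; split=> [/rect_P_up[_ mg]|/rect_low2_mid mg].
  by apply: rect_low2 => //; exact: rect_G_supp_low1.
by apply/rect_P_up; split=> //; exact: G_supp_SL gg.
Qed.

End Next.
End OneRectangle.
End RectangleGroups.

(** * Ranks of South-West corners *)

Section Ranks.
Import GRing.Theory.
Local Open Scope ring_scope.
Variables (k : closedFieldType) (n : nat) (a : 'I_n).
Local Notation M := 'M[k]_n.+1.
Implicit Types (g h x A B : M) (u v w : 'S_n.+1) (i j : 'I_n.+1) (c : nat).

Definition low_proj : M := dproj k (fun j : 'I_n.+1 => (j <= a)%N).
(** The rank of the rows from [c] on and columns up to [a]. It depends only on the coset of [g]
    modulo the maximal parabolic at [a], and is [ht a u c] on representatives of [u]. *)
Definition corner_rank c g : nat := \rank (dproj k (from c) * g * low_proj)%R.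

Lemma mxrank_mull A B : (\rank (A * B)%R <= \rank B)%N.
Proof. exact: mxrankM_maxr. Qed.

Lemma corner_rank_mono c d g : (c <= d)%N -> (corner_rank d g <= corner_rank c g)%N.
Proof.
move=> cd; rewrite /corner_rank.
have -> : dproj k (from d : pred 'I_n.+1) = dproj k (from d) * dproj k (from c).
  apply/matrixP => i j; rewrite dprojl !dprojE /from.
  by case: (leqP d i) => // di; rewrite (leq_trans cd di).
by rewrite -!mulrA mxrank_mull.
Qed.

Lemma corner_rank_step c g : (corner_rank c g <= (corner_rank c.+1 g).+1)%N.
Proof.
rewrite /corner_rank.
have -> : dproj k (from c : pred 'I_n.+1) =
    dproj k (from c.+1) + dproj k (fun i => i == c :> nat).
  apply/matrixP => i j; rewrite [RHS]mxE !dprojE /from.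
  by case: (ltngtP c i) => _ /=; rewrite ?mulr0n ?addr0 ?add0r.
rewrite 2!mulrDl; apply: leq_trans (mxrank_add _ _) _; rewrite -[X in (_ <= X)%N]addn1 leq_add2l.
rewrite -mulrA; apply: leq_trans (mxrankM_maxl _ _) _; rewrite rank_dproj.
apply/card_le1_eqP => y z; rewrite unfold_in [z \in _]unfold_in => /eqP yE /eqP zE.
by apply: val_inj; rewrite /= yE zE.
Qed.

Lemma corner_rank_add c d g : (corner_rank c g <= corner_rank (c + d) g + d)%N.
Proof.
elim: d => [|d IH]; first by rewrite !addn0.
by apply: leq_trans IH _; rewrite ![in X in (_ <= X)%N]addnS -[X in (_ <= X)%N]addSn leq_add2r corner_rank_step.
Qed.

Lemma corner_rank_upto c g h : upto c g -> (corner_rank c (g * h) <= corner_rank c h)%N.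
Proof.
move=> /uptoP e; rewrite /corner_rank mulrA e.
by rewrite -[X in \rank X]mulrA -[X in \rank (X)]mulrA; apply: leq_trans (mxrank_mull _ _) _; rewrite mulrA.
Qed.

Lemma corner_rank_represents u x c : represents u x -> corner_rank c x = ht a u c.
Proof.
move=> rx; have [d [_ xE _ _]] := represents_entries rx.
have -> : corner_rank c x =
    \rank (dproj k (fun y : 'I_n.+1 => (c <= y)%N && (u y <= a)%N) * x)%R.
  congr (\rank _); apply/matrixP => i j; rewrite dprojr !dprojl /from /= xE.
  case: (c <= i)%N => //=; last by case: ifP.
  case: (eqVneq (u i) j) => [->|_]; first by case: ifP.
  by rewrite mul0r !if_same.
rewrite mxrankMfree ?rank_dproj ?ht_card //.
by rewrite row_free_unit; apply: SL_unit; case: rx.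
Qed.

Section Rect.
Variables (w u : 'S_n.+1) (lo c e : nat).
Hypothesis r : rect a w u lo c e.
Let mid := (lo + (e - c))%N.

(** On [[lo, c]] the bound is constant while the rank can only fall. On [[c, e]] the bound grows by
    one with each row added back from [e], and the rank by at most one. *)
Lemma corner_rank_fill g :
  (forall y, (y <= lo)%N || (e <= y)%N -> (corner_rank y g <= ht a (w * u)%g y)%N) ->
  forall y, (corner_rank y g <= ht a (w * u)%g y)%N.
Proof.
move=> hg y; case: (rect_h r) => lc ce en fl st _ _ _ _ _.
case: (boolP ((y <= lo)%N || (e <= y)%N)) => [|yo]; first exact: hg.
case: (leqP y c) => yc.
  rewrite fl; last lia.
  by apply: leq_trans (corner_rank_mono _ _) (hg lo _); lia.
have h1 := corner_rank_add y (e - y) g.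
have -> : ht a (w * u)%g y = (ht a (w * u)%g e + (e - y))%N.
  by have := st y; have := st e; lia.
apply: leq_trans h1 _; rewrite subnKC; last lia.
by rewrite leq_add2r hg // leqnn orbT.
Qed.

(** The rows of [h * x] from [e] on already realise the whole rank allowed to the rows
    from [mid] on, so the latter are combinations of the former. *)
Lemma corner_rank_vanish h x : represents (w * u)%g x -> SL h -> upto lo h -> upto e h ->
  (corner_rank mid (h * x) <= ht a u mid)%N ->
  forall i j, (mid <= i)%N -> ((w * u)%g j <= a)%N -> (j < e)%N -> h i j = 0.
Proof.
move=> rx sh hlo he hr i j mi ja je.
have [d [d0 _ AE _]] := represents_entries rx.
case: (rect_h r) => lc ce en _ _ _ _ out _ fl'.
have hm : ht a u mid = ht a (w * u)%g e.
  by rewrite fl' // /mid; lia.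
set A := dproj k (from mid) * (h * x) * low_proj.
have PA : dproj k (from e) * A = dproj k (from e) * (h * x) * low_proj.
  rewrite /A !mulrA; congr (_ * _ * _ * _); rewrite dprojM.
  apply/matrixP => p q; rewrite !dprojE /from /= /mid.
  by case: (leqP e p) => //= ep; have -> : (lo + (e - c) <= p)%N by lia.
have [|C AC] := @rowspace_eq _ _ (dproj k (from e)) A.
  apply: (leq_trans hr); rewrite hm -(corner_rank_represents _ rx) /corner_rank PA.
  have -> : dproj k (from e) * x * low_proj =
      (dproj k (from e) * h^-1) * (dproj k (from e) * (h * x) * low_proj).
    have /uptoP e1 := upto_inv sh he.
    by rewrite !mulrA -e1 -(mulrA _ h^-1 h) mulVr ?mulr1 // SL_unit.
  exact: mxrank_mull.
have : A i ((w * u)%g j) = 0.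
  rewrite AC PA mxE big1 // => l _; rewrite dprojr dprojl AE permK /from.
  case: ifP => _; last by rewrite mulr0.
  case: leqP => el; last by rewrite mulr0.
  by rewrite he ?mul0r ?mulr0.
rewrite /A dprojr dprojl AE permK ja /from mi => /eqP.
by rewrite mulf_eq0 (negbTE (d0 _)) orbF => /eqP.
Qed.

End Rect.
End Ranks.

(** * The action on sequences of representatives, and cosets *)

Section Sequences.
Import GRing.Theory.
Local Open Scope ring_scope.
Local Open Scope classical_set_scope.
Variables (k : closedFieldType) (n : nat).
Local Notation M := 'M[k]_n.+1.
Implicit Types (g h p q : M) (x y z : seq M) (u v w : 'S_n.+1) (ws : seq 'S_n.+1).

Lemma act_seq_cons w ws p x y : ws <> [::] ->
  act_seq (w :: ws) p x y <->
  exists g g' p' x' y', [/\ x = g :: x', y = g' :: y' & 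
    [/\ P_low (wprod ws) p', p * g = g' * p', cell_closure w g' & act_seq ws p' x' y']].
Proof.
case: ws => // v ws _; split; last first.
  by case=> g [g' [p' [x' [y' [-> -> [? ? ? ?]]]]]] /=; exists p'.
case: x => [//|g x]; case: y => [//|g' y] /= [p' [? ? ? ?]].
by exists g, g', p', x, y.
Qed.

Lemma act_seq_one w p x y :
  act_seq [:: w] p x y <-> exists g, x = [:: g] /\ y = [:: p * g].
Proof.
split=> [|[g [-> ->]]] //.
by case: x => [//|g x]; case: y => [//|g' y] /= [-> -> ->]; exists g.
Qed.

(** This is the equivariance of [pihat], already true for representatives. *)
Lemma act_seq_prod ws p x y : act_seq ws p x y ->
  \prod_(g <- y) g = p * \prod_(g <- x) g.
Proof.
elim: ws p x y => [//|w ws IH] p x y.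
case: (eqVneq ws [::]) => [->|/eqP ws0].
  by move=> /act_seq_one[g [-> ->]]; rewrite !big_seq1.
move=> /(act_seq_cons _ _ _ _ ws0)[g [g' [p' [x' [y' [-> -> [_ e _ /IH h]]]]]]].
by rewrite !big_cons h !mulrA e.
Qed.

Lemma act_seq_comp ws p q x y z : act_seq ws p x y -> act_seq ws q y z ->
  act_seq ws (q * p) x z.
Proof.
elim: ws p q x y z => [//|w ws IH] p q x y z.
case: (eqVneq ws [::]) => [->|/eqP ws0].
  move=> /act_seq_one[g [-> ->]] /act_seq_one[g2 [[<-] ->]].
  by apply/act_seq_one; exists g; rewrite mulrA.
move=> /(act_seq_cons _ _ _ _ ws0)[g [g' [p' [x' [y' [-> -> [Pp e _ h]]]]]]].
move=> /(act_seq_cons _ _ _ _ ws0)[g2 [g3 [q' [x2 [y3 [[<- <-] -> [Pq e' cc h']]]]]]].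
apply/(act_seq_cons _ _ _ _ ws0); exists g, g3, (q' * p'), x', y3.
split=> //; split=> //; last exact: IH h h'.
  exact: gen_mul.
by rewrite -mulrA e mulrA e' mulrA.
Qed.

(** Reflexivity is not automatic, as the relation asks the terms of its target, except the last, to
    lie in cell closures. Targets satisfy this by construction. *)
Lemma act_seq_target ws p x y : act_seq ws p x y -> act_seq ws 1 y y.
Proof.
elim: ws p x y => [//|w ws IH] p x y.
case: (eqVneq ws [::]) => [->|/eqP ws0].
  by move=> /act_seq_one[g [_ ->]]; apply/act_seq_one; exists (p * g); rewrite mul1r.
move=> /(act_seq_cons _ _ _ _ ws0)[g [g' [p' [x' [y' [_ -> [Pp e cc h]]]]]]].
apply/(act_seq_cons _ _ _ _ ws0); exists g', g', 1, y', y'.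
by split=> //; split=> //; [exact: gen_1|rewrite mulr1 mul1r|exact: IH h].
Qed.

Lemma Xhat_cons w ws X : ws <> [::] ->
  Xhat (k := k) (w :: ws) X <->
  exists g Y, [/\ cell_closure w g, Xhat ws Y & X = contracted_class w ws g Y].
Proof. by case: ws. Qed.

Lemma Xhat_refl (a : 'I_n) ws X x : chain a ws -> Xhat (k := k) ws X -> X x ->
  act_seq ws 1 x x.
Proof.
case: ws => [//|w ws] [[lo [c [e r]]] _].
case: (eqVneq ws [::]) => [->|/eqP ws0].
  move=> /= [c' _ ->] /= [g _ <-]; split=> //.
  by rewrite mul1r.
move=> /(Xhat_cons _ _ ws0)[g [Y [/(rect_cell_closure r) cg _ ->]]].
move=> [q [t [[_ Gq] [s Ys st] ->]]].
apply/(act_seq_cons _ _ _ _ ws0); exists (g * q), (g * q), 1, t, t.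
split=> //; split; rewrite ?mul1r ?mulr1 //; first exact: gen_1.
- by apply/(rect_cell_closure r); exact: gen_mul.
- exact: act_seq_target st.
Qed.

Lemma translateM (g h : M) (A : set M) : translate g (translate h A) = translate (g * h) A.
Proof.
apply/seteqP; split=> [_ [_ [z Az <-] <-]|_ [z Az <-]]; first by exists z; rewrite ?mulrA.
by exists (h * z); rewrite ?mulrA //; exists z.
Qed.

Lemma translate1 (A : set M) : translate 1 A = A.
Proof.
apply/seteqP; split=> [_ [z Az <-]|z Az]; first by rewrite mul1r.
by exists z; rewrite ?mul1r.
Qed.

Lemma parabolic_SL J g : parabolic J g -> SL g.
Proof. by move=> /parabolicP[]. Qed.

Lemma translate_parabolic (J : {set 'I_n}) g h : SL g ->
  translate g (parabolic J) = translate h (parabolic J) <-> parabolic J (g^-1 * h).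
Proof.
move=> sg; split=> [e|Pgh].
  have : translate h (parabolic J) h by exists 1; rewrite ?mulr1 //; exact: gen_1.
  by rewrite -e => -[z Pz <-]; rewrite mulKr // SL_unit.
have hE : h = g * (g^-1 * h) by rewrite mulVKr // SL_unit.
rewrite hE -translateM; congr (translate _ _).
apply/seteqP; split=> [z Pz|_ [z Pz <-]]; last exact: gen_mul.
exists ((g^-1 * h)^-1 * z); first exact: gen_mul (gen_inv Pgh) Pz.
by rewrite mulVKr // SL_unit //; exact: parabolic_SL Pgh.
Qed.

Lemma wpoint_translate (J : {set 'I_n}) w (x : M) : represents w x ->
  wpoint w (parabolic J) = translate x (parabolic J).
Proof.
move=> rx; apply/seteqP; split=> [_ [x' [h [rx' Ph ->]]]|_ [h Ph <-]]; last by exists x, h.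
exists (x^-1 * x' * h); last first.
  by rewrite -!mulrA mulVKr // SL_unit //; case: rx.
apply: gen_mul Ph; apply/parabolicP.
have := represents_mul (represents_inv rx) rx'; rewrite mulVg => /representsP[sx [d xE]].
split=> // l _ i j jl li; rewrite xE perm1.
by case: eqP => [ij|_]; [move: jl li; rewrite ij; lia|rewrite mul0r].
Qed.

End Sequences.

(** * Closed conditions, and conjugation of the torus *)

Section Closedness.
Import GRing.Theory.
Local Open Scope ring_scope.
Local Open Scope classical_set_scope.
Variables (k : closedFieldType) (n : nat).
Local Notation M := 'M[k]_n.+1.
Local Notation poly := (mpoly.mpoly (n.+1 * n.+1) k).
Implicit Types (g h : M) (i j : 'I_n.+1) (w u : 'S_n.+1) (a : 'I_n).

Definition generic_mx : 'M[poly]_n.+1 :=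
  \matrix_(i, j) mpoly.mpolyX k (mpoly.mnm1 (mxvec_index i j)).

Lemma generic_mxE g : map_mx (mpoly.meval (fun l => mxvec g 0 l)) generic_mx = g.
Proof. by apply/matrixP => i j; rewrite !mxE mpoly.mevalXU mxvecE. Qed.

Lemma generic_adjE g : map_mx (mpoly.meval (fun l => mxvec g 0 l)) (\adj generic_mx) = \adj g.
Proof. by rewrite map_mx_adj generic_mxE. Qed.

Lemma adj_SL g : SL g -> \adj g = g^-1.
Proof.
rewrite /SL /= => dg; have e : g * \adj g = 1 by rewrite -mulmxE mul_mx_adj dg.
have ug : g \is a GRing.unit by rewrite unitmxE dg unitr1.
by rewrite -[LHS](mulKr ug) e mulr1.
Qed.

(** Conditions on the adjugate are conditions on [g^-1]: with them, both inclusions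
    of a flag condition [E <= g F <= E'] become vanishing of polynomial entries. *)
Lemma closed_zero_entries (S S' : 'I_n.+1 -> 'I_n.+1 -> Prop) :
  zariski_closed [set g : M | (forall i j, S i j -> g i j = 0) /\
                              (forall i j, S' i j -> \adj g i j = 0)].
Proof.
exists [set p : poly | exists i j, (S i j /\ p = generic_mx i j) \/
                            (S' i j /\ p = \adj generic_mx i j)].
apply/seteqP; split=> g.
  move=> [h1 h2] p [i [j [[Sij ->]|[Sij ->]]]].
    by rewrite -(h1 i j Sij) -{2}(generic_mxE g) [RHS]mxE.
  by rewrite -(h2 i j Sij) -(generic_adjE g) [RHS]mxE.
move=> h; split=> i j Sij.
  by rewrite -(generic_mxE g) mxE; apply: h; exists i, j; left.
by rewrite -(generic_adjE g) mxE; apply: h; exists i, j; right.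
Qed.

(** Conjugation is linear in the entries, so substituting linear forms in the equations gives those
    of the preimage. *)
Lemma zariski_closed_conj (x : M) (F : set M) :
  zariski_closed F -> zariski_closed [set g | F (x * g * x^-1)].
Proof.
case=> E ->.
pose L : 'M[k]_(n.+1 * n.+1) := lin_mx (mulmxr x^-1 \o mulmx x).
have LE g : mxvec (x * g * x^-1) = mxvec g *m L by rewrite mul_vec_lin.
pose q (j : 'I_(n.+1 * n.+1)) : poly := \sum_l L l j *: mpoly.mpolyX k (mpoly.mnm1 l).
pose lq : (n.+1 * n.+1).-tuple poly := [tuple q j | j < n.+1 * n.+1].
have ev g p : mpoly.meval (fun l => mxvec g 0 l) (mpoly.comp_mpoly lq p) =
              mpoly.meval (fun l => mxvec (x * g * x^-1) 0 l) p.
  rewrite mpoly.comp_mpoly_meval; apply: mpoly.meval_eq => l.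
  rewrite tnth_mktuple /q raddf_sum LE mxE; apply: eq_bigr => l' _.
  by rewrite /= mpoly.mevalZ mpoly.mevalXU mulrC.
exists [set mpoly.comp_mpoly lq p | p in E].
apply/seteqP; split=> g /= h.
  by move=> _ [p Ep <-]; rewrite ev; exact: h.
by move=> p Ep; rewrite -ev; apply: h; exists p.
Qed.

Lemma zariski_connected_conj (x : M) (C : set M) : SL x -> zariski_connected C ->
  zariski_connected [set x * g * x^-1 | g in C].
Proof.
move=> sx hC F1 F2 /(zariski_closed_conj x) c1 /(zariski_closed_conj x) c2 sub disj.
have [] := hC _ _ c1 c2.
- by move=> g Cg /=; apply: (sub (x * g * x^-1)); exists g.
- rewrite -subset0 => g [Cg [F1g F2g]].
  have : ([set x * g * x^-1 | g in C] `&` (F1 `&` F2)) (x * g * x^-1).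
    by split; [exists g|split].
  by rewrite disj.
- by move=> h; left=> _ [g Cg <-]; exact: h.
- by move=> h; right=> _ [g Cg <-]; exact: h.
Qed.

Lemma neutral_component_conj (x : M) (H : set M) : SL x ->
  (forall g, H g -> H (x * g * x^-1)) ->
  forall g, neutral_component H g -> neutral_component H (x * g * x^-1).
Proof.
move=> sx hH g [C [CH cC C1 Cg]]; exists [set x * g * x^-1 | g in C]; split.
- by move=> _ [y Cy <-]; apply: hH; exact: CH.
- exact: zariski_connected_conj.
- by exists 1 => //; rewrite mulr1 mulrV // SL_unit.
- by exists g.
Qed.

(** Conjugation by [x] sends connected subsets of the torus part of [G_w] through [1] to such
    subsets; the same inclusion for [x^-1] gives equality. *)
Lemma normalises_T_supp w u (x : M) : represents u x -> G_supp w x ->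
  normalises x (T_supp (k := k) w).
Proof.
have step v (y : M) : represents v y -> G_supp w y ->
    forall t, T_supp w t -> T_supp w (y * t * y^-1).
  move=> ry gy; apply: neutral_component_conj; first by case: ry.
  move=> t [[st dt] gt]; split; last first.
    by apply: gen_mul (gen_inv gy); exact: gen_mul.
  have sy : SL y by case: ry.
  split; first by apply: SL_mul (SL_inv sy); exact: SL_mul.
  have ryi := represents_inv ry.
  have [d [_ yE _ _]] := represents_entries ry.
  have [d' [_ _ AE _]] := represents_entries ryi.
  apply/is_diag_mxP => i j ij; rewrite AE invgK mxE big1 ?mul0r // => l _.
  rewrite yE; case: (eqVneq (v i) l) => [<-|_]; last by rewrite !mul0r.
  have /is_diag_mxP -> := dt; first by rewrite mulr0.
  by apply: contraNneq ij => /val_inj/perm_inj ->.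
move=> rx gx; apply/seteqP; split=> [_ [t Tt <-]|t Tt]; first exact: step rx gx t Tt.
exists (x^-1 * t * x).
  have := step _ _ (represents_inv rx) (gen_inv gx) t Tt; by rewrite invrK.
have sx : SL x by case: rx.
by rewrite !mulrA mulrV ?SL_unit // mul1r mulrK // SL_unit.
Qed.

End Closedness.

(** * Schubert conditions on the fibres, and fixed points of the action *)

Section Fibres.
Import GRing.Theory.
Local Open Scope ring_scope.
Local Open Scope classical_set_scope.
Variables (k : closedFieldType) (n : nat) (a : 'I_n).
Local Notation M := 'M[k]_n.+1.
Local Notation P := (@parabolic k n (~: [set a])%SET).
Implicit Types (g h p q b x : M) (t : seq M) (u v w : 'S_n.+1) (ws : seq 'S_n.+1)
  (i j y z : 'I_n.+1) (X Y : set (seq M)).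

Lemma maximal_parabolicP h : P h <-> SL h /\ upto a.+1 h.
Proof.
rewrite parabolicP /block_upper; split=> -[sh uh]; split=> //.
  by apply: uh; rewrite !inE negbK.
by move=> i; rewrite !inE negbK => /eqP ->.
Qed.

Lemma corner_rank_P (c : nat) g h : P h -> (corner_rank a c (g * h) <= corner_rank a c g)%N.
Proof.
move=> /maximal_parabolicP[_ uh]; rewrite /corner_rank.
have e : h * low_proj k a = low_proj k a * (h * low_proj k a).
  apply/matrixP => i j; rewrite [RHS]dprojl !dprojr.
  case: leqP => ia //; case: leqP => ja //; exact: uh.
by rewrite -!mulrA e !mulrA -[X in \rank X]mulrA; exact: mxrankM_maxl.
Qed.

Lemma card_lt (c : nat) : (c <= a.+1)%N -> (c <= #|fun j : 'I_n.+1 => (j < c)%N|)%N.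
Proof.
case: c => // c ca; have cn : (c <= n)%N by have := ltn_ord a; lia.
rewrite -[X in (X <= _)%N](ht_0 1%g cn) ht_card.
by apply: subset_leq_card; apply/fintype.subsetP => i; rewrite !unfold_in perm1.
Qed.

(** By the condition on [g^-1], the span of the first [a.+1] columns of [g] contains the first [c]
    basis vectors; modulo these its dimension is at most [a.+1 - c]. *)
Lemma rank_full_columns (c : nat) g : SL g -> (c <= a.+1)%N ->
  (forall i j, (a < i)%N -> (j < c)%N -> g^-1 i j = 0) ->
  (corner_rank a c g <= a.+1 - c)%N.
Proof.
move=> sg ca h.
(* Factoring [low_proj] through dimension [a.+1] makes the rank bound for a zero product give [a.+1]
   instead of [n.+1]. *)
pose I : 'M[k]_(n.+1, a.+1) := \matrix_(i, j) (i == j :> nat)%:R.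
have II : I *m I^T = low_proj k a.
  apply/matrixP => i j; rewrite mxE dprojE; case: (leqP i a) => ia /=.
    rewrite (bigD1 (Ordinal (ia : (i < a.+1)%N))) //= big1 ?addr0 => [|l].
      by rewrite !mxE eqxx mul1r eq_sym.
    by rewrite !mxE -val_eqE /= [_ == (i : nat)]eq_sym => /negbTE ->; rewrite mul0r.
  rewrite big1 // => l _; rewrite !mxE; case: eqP => [il|_]; last by rewrite mul0r.
  by have := ltn_ord l; rewrite -il; lia.
pose Q : M := dproj k (fun j => (j < c)%N).
have paQ : low_proj k a * (g^-1 * Q) = g^-1 * Q.
  apply/matrixP => i j; rewrite dprojl dprojr; case: (leqP i a) => // ia.
  by case: ifP => // jc; rewrite h.
have rQ : (c <= \rank Q)%N by rewrite rank_dproj; exact: card_lt.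
have z : (dproj k (from c) * g *m I) *m (I^T *m (g^-1 * Q)) = 0.
  rewrite mulmxA -(mulmxA _ I) II !mulmxE -mulrA paQ !mulrA mulrK ?SL_unit //.
  apply/matrixP => i j; rewrite dprojr dprojE mxE /from.
  by case: (ltnP j c) => // jc; case: eqP => [->|]; rewrite ?andbF // leqNgt jc.
have := mulmx0_rank_max z.
have r1 : (\rank Q <= \rank (I^T *m (g^-1 * Q)))%N.
  apply: (leq_trans _ (mxrankM_maxr I _)); rewrite mulmxA II mulmxE paQ.
  rewrite -{1}(mulVKr (SL_unit sg) Q).
  exact: mxrankM_maxr.
have r2 : (corner_rank a c g <= \rank (dproj k (from c) * g *m I))%N.
  by rewrite /corner_rank -II -mulmxE mulmxA; exact: mxrankM_maxl.
by lia.
Qed.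

Section Last.
Variables (w : 'S_n.+1) (lo c e : nat).
Hypothesis r : rect a w 1%g lo c e.

Lemma last_mid : (lo + (e - c))%N = a.+1.
Proof.
have := rect_addable_mid r; rewrite /addable !perm1 val_simple1 val_simple2 => /andP[h1 h2].
by rewrite -(rect_cornerE r); lia.
Qed.

Lemma last_grass : grass a w. Proof. by have := rect_grass1 r; rewrite mulg1. Qed.

Lemma last_ht (y : nat) : (y <= lo)%N || (e <= y)%N -> ht a w y = (a.+1 - y)%N.
Proof.
case: (rect_h r) => _ _ _ _ _ _ _ out _ _; rewrite mulg1 in out.
by move=> /out <-; rewrite ht_1 //; exact/ltnW.
Qed.

(** With [E_i] the span of the first [i] basis vectors, this says that [g] maps [E_{a+1}] to a
    subspace between [E_lo] and [E_e]. It is a closed condition containing the Bruhat cell of [w],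
    hence valid on [X(w)]. *)
Let vanishing g := (forall i j, (e <= i)%N && (j <= a)%N -> g i j = 0) /\
  (forall i j, (a < i)%N && (j < lo)%N -> \adj g i j = 0).

Lemma last_P_up : P_up (k := k) w = P.
Proof. by rewrite /P_up (grass_I_up last_grass (rect_neq1 r)). Qed.

Lemma vanishing_mul g h : SL g -> P h -> vanishing g -> vanishing (g * h).
Proof.
move=> sg Ph [v1 v2]; have /maximal_parabolicP[sh uh] := Ph.
split=> i j /andP[hi hj].
  rewrite mxE big1 // => l _; case: (leqP l a) => la; first by rewrite v1 ?hi ?la ?mul0r.
  by rewrite uh ?mulr0.
rewrite adj_SL; last exact: SL_mul.
rewrite invrM ?SL_unit // mxE big1 // => l _.
case: (leqP l a) => la; first by rewrite (upto_inv sh uh) ?mul0r.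
by rewrite -(adj_SL sg) v2 ?la ?mulr0.
Qed.

Lemma vanishing_cell b x : borel b -> represents w x -> vanishing (b * x).
Proof.
move=> [sb tb] rx; have [d [_ _ AE EA]] := represents_entries rx.
have sx : SL x by case: rx.
have side z : (w z <= a)%N = ((z < lo) || (c <= z < e))%N.
  by rewrite -ltnS -last_mid (rect_swap_mid r).
have [lc ce _] := rect_bounds r.
split=> i j /andP[hi hj].
  rewrite AE tb ?mul0r //; have := side (w^-1%g j); rewrite permKV hj; lia.
rewrite adj_SL; last exact: SL_mul.
rewrite invrM ?SL_unit // EA (upto_inv (c := w^-1%g i) sb) ?mulr0 //.
  by move=> p q qp ip; apply: tb; lia.
by have := side (w^-1%g i); rewrite permKV leqNgt hi; lia.
Qed.

Lemma schubert_vanishing (C : set M) : schubert w C ->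
  exists2 g, SL g & C = translate g P /\ vanishing g.
Proof.
rewrite /schubert last_P_up => -[_ hC].
apply: (hC [set C | exists2 g, SL g & C = translate g P /\ vanishing g]).
  exists [set g | vanishing g]; first exact: closed_zero_entries.
  apply/seteqP; split=> g [sg vg]; split=> //; last by exists g.
  case: vg => g' sg' [gE vg'].
  have -> : g = g' * (g'^-1 * g) by rewrite mulVKr // SL_unit.
  by apply: vanishing_mul => //; apply/translate_parabolic.
move=> _ [b [x [bb rx ->]]]; exists (b * x); first by apply: SL_mul; [case: bb|case: rx].
by split=> //; exact: vanishing_cell.
Qed.

Lemma schubert_rank (C : set M) g (y : nat) : schubert w C -> C g ->
  (corner_rank a y g <= ht a w y)%N.
Proof.
move=> /schubert_vanishing[g0 sg0 [-> v0]] [h Ph <-].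
have := @corner_rank_fill _ _ _ _ _ _ _ _ r (g0 * h); rewrite mulg1; apply=> {}y hy.
have [v1 v2] := vanishing_mul sg0 Ph v0.
have sg : SL (g0 * h) by apply: SL_mul => //; exact: parabolic_SL Ph.
rewrite last_ht //; case/orP: hy => hy.
  apply: rank_full_columns => //.
    by have := last_mid; case: (rect_bounds r); lia.
  by move=> i j ai jy; rewrite -adj_SL // v2 // ai (leq_trans jy hy).
rewrite /corner_rank; have -> : dproj k (from y) * (g0 * h) * low_proj k a = 0.
  apply/matrixP => i j; rewrite dprojr dprojl [RHS]mxE /from.
  case: leqP => // ja; case: leqP => // yi; apply: v1.
  by rewrite ja (leq_trans hy yi).
by rewrite mxrank0.
Qed.

End Last.

Lemma pihat_cons w ws X g Y : ws <> [::] -> chain a ws -> Xhat ws Y ->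
  X = contracted_class w ws g Y -> pihat P X = translate g (pihat P Y).
Proof.
move=> ws0 ch XY ->; apply/seteqP; split=> h.
  move=> [_ [h' [[q [t [[_ Gq] [s Ys st] ->]]] Ph' ->]]].
  exists (\prod_(y <- s) y * h'); first by exists s, h'.
  rewrite big_cons (act_seq_prod st) !mulrA -(mulrA g q) mulrV ?mulr1 //.
  exact: SL_unit (G_supp_SL Gq).
move=> [_ [s [h' [Ys Ph' ->]]] <-]; exists (g :: s), h'; split=> //; last first.
  by rewrite big_cons mulrA.
exists 1, s; rewrite mulr1; split=> //; first by split; exact: gen_1.
by exists s => //; rewrite invr1; exact: Xhat_refl ch XY Ys.
Qed.

Lemma pihat_one (C : set M) : pihat P [set [:: x] | x in C] = [set g * h | g in C & h in P].
Proof.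
apply/seteqP; split=> [_ [_ [h [[x Cx <-] Ph ->]]]|_ [x Cx [h Ph <-]]].
  by exists x => //; exists h => //; rewrite big_seq1.
by exists [:: x], h; split=> //; [exists x|rewrite big_seq1].
Qed.

(** [g1] preserves the flag steps up to [lo] and from [e] on, where [u] and [w * u] have equal
    heights, so the bounds for [Y] carry over; [corner_rank_fill] gives those in between. *)
Lemma pihat_rank ws X g : ws <> [::] -> chain a ws -> Xhat ws X -> pihat P X g ->
  forall y : nat, (corner_rank a y g <= ht a (wprod ws) y)%N.
Proof.
elim: ws X g => [//|w ws IH] X g _ [[lo [c [e r]]] ch].
case: (eqVneq ws [::]) => [ws0|/eqP ws0].
  move: r; rewrite wprod_cons ws0 /wprod big_nil => r [C sC ->].
  rewrite pihat_one // => -[x Cx [h Ph <-]] y; rewrite mulg1.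
  exact: leq_trans (corner_rank_P _ _ Ph) (schubert_rank r _ sC Cx).
move=> /(Xhat_cons _ _ ws0)[g1 [Y [/(rect_cell_closure r) G1 XY XE]]].
rewrite (pihat_cons ws0 ch XY XE) => -[g' Yg' <-].
have hg' := IH Y g' ws0 ch XY Yg'.
rewrite wprod_cons; apply: (corner_rank_fill r) => y hy.
have up : upto y g1 by apply: (fixes_upto (rect_fixes r G1)).
apply: leq_trans (corner_rank_upto a g' up) _.
by case: (rect_h r) => _ _ _ _ _ _ _ out _ _; rewrite -out.
Qed.

Section Step.
Variables (w u : 'S_n.+1) (lo c e : nat).
Hypothesis r : rect a w u lo c e.
Hypothesis u1 : u <> 1%g.
Let mid := (lo + (e - c))%N.

Lemma swap_side (z : 'I_n.+1) : (w z < mid)%N ->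
  (z < lo)%N \/ (c <= z < e)%N /\ ((w * u)%g z <= a)%N.
Proof.
rewrite (rect_swap_mid r) => /orP[|ce]; [by left|right; split=> //].
by rewrite ht_side; have [_ -> //] := rect_side1 (rect_h r) z.
Qed.

Lemma swap_side' (z : 'I_n.+1) : (mid <= w z)%N ->
  (e <= z)%N \/ (lo <= z < c)%N /\ (a < (w * u)%g z)%N.
Proof.
rewrite leqNgt (rect_swap_mid r) => h; case: (leqP e z) => ez; [by left|right].
have lc : (lo <= z < c)%N by lia.
split=> //; rewrite ltnNge ht_side; have [-> //] := rect_side1 (rect_h r) z.
Qed.

(** The entries [p0 y z] with [w z < mid <= w y] must vanish. If [z < lo] or [e <= y], a flag step
    kills them. Otherwise [w * u] sends [z] up to [a] and [y] beyond, and they vanish because [p0]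
    fixes the coset of [x]. *)
Lemma conj_upto_mid p0 x x1 : represents (w * u)%g x -> represents w x1 ->
  upto lo p0 -> upto e p0 -> P (x^-1 * p0 * x) -> upto mid (x1^-1 * p0 * x1).
Proof.
move=> rx rx1 lp ep /maximal_parabolicP[_ up].
have [d [d0 _ AE EA]] := represents_entries rx.
have [f [_ _ AE1 EA1]] := represents_entries rx1.
move=> i j jm mi; rewrite AE1 EA1.
set y := (w^-1%g i); set z := (w^-1%g j).
suff -> : p0 y z = 0 by rewrite mulr0 mul0r.
have := @swap_side z; rewrite permKV => /(_ jm) hz.
have := @swap_side' y; rewrite permKV => /(_ mi) hy.
case: (rect_bounds r) => lc ce _.
case: hz => [zl|[zc za]]; first by apply: lp => //; case: hy; lia.
case: hy => [ye|[yc ya]]; first by apply: ep => //; lia.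
have := up ((w * u)%g y) ((w * u)%g z); rewrite AE EA !permK => /(_ _ ya) /=.
rewrite ltnS => /(_ za) /eqP; rewrite !mulf_eq0 invr_eq0 !(negbTE (d0 _)) orbF.
by move=> /eqP.
Qed.

Lemma fibre_point g1 b x x1 : G_supp w g1 -> P_low (w * u)%g b ->
  represents (w * u)%g x -> represents w x1 -> G_supp w x1 ->
  (corner_rank a mid (g1^-1 * b * x) <= ht a u mid)%N ->
  P_low u (g1^-1 * b * x1).
Proof.
move=> G1 Pb rx rx1 Gx1 hr.
have Ph : P_low (w * u)%g (g1^-1 * b).
  by apply: gen_mul Pb; apply: gen_inv; exact: (rect_G_supp_low1 r).
have [sh lh eh] := rect_low1 r Ph.
apply: (rect_low2 r u1); first by apply: gen_mul Ph _; exact: (rect_G_supp_low1 r).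
have van := corner_rank_vanish r rx sh lh eh hr.
have [f [_ _ AE1 _]] := represents_entries rx1.
move=> i j jm mi; rewrite AE1; set z := (w^-1%g j).
suff -> : (g1^-1 * b) i z = 0 by rewrite mul0r.
have := @swap_side z; rewrite permKV => /(_ jm) [zl|[zc za]].
  by apply: lh => //; rewrite /mid in mi; lia.
by apply: van => //; lia.
Qed.

End Step.

Lemma act_fixed ws X b x p : ws <> [::] -> chain a ws -> Xhat ws X ->
  represents (wprod ws) x -> P_low (wprod ws) b -> P_low (wprod ws) p ->
  pihat P X = translate (b * x) P -> P (x^-1 * (b^-1 * p * b) * x) ->
  act_point ws p X = X.
Proof.
elim: ws X b x p => [//|w ws IH] X b x p _ [[lo [c [e r]]] ch].
case: (eqVneq ws [::]) => [ws0|/eqP ws0].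
  move: r; rewrite wprod_cons ws0 /wprod big_nil => r [C sC ->].
  rewrite pihat_one //= => rx Pb Pp CE fx.
  have sx : SL x by case: rx.
  have [sb _ _] := rect_low1 r Pb; have [sp _ _] := rect_low1 r Pp.
  have [g0 sg0 [CE0 _]] := schubert_vanishing r sC.
  have CC : [set g * h | g in C & h in P] = C.
    apply/seteqP; split=> [_ [g Cg [h Ph <-]]|g Cg]; last first.
      by exists g => //; exists 1; rewrite ?mulr1 //; exact: gen_1.
    move: Cg; rewrite CE0 => -[h' Ph' <-]; exists (h' * h); rewrite ?mulrA //.
    exact: gen_mul.
  have pC : translate p C = C.
    rewrite -CC CE translateM; apply/esym/translate_parabolic; first exact: SL_mul.
    rewrite (_ : _ * _ = x^-1 * (b^-1 * p * b) * x) //.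
    by rewrite invrM ?SL_unit // !mulrA.
  apply/seteqP; split.
    move=> y [_ [g Cg <-]] /act_seq_one[g' [[<-] ->]]; exists (p * g) => //.
    by rewrite -pC; exists g.
  move=> _ [g Cg <-]; move: Cg; rewrite -{1}pC => -[g' Cg' <-].
  by exists [:: g']; [exists g'|apply/act_seq_one; exists g'].
move=> /(Xhat_cons _ _ ws0)[g1 [Y [/(rect_cell_closure r) G1 XY XE]]].
rewrite wprod_cons => rx Pb Pp XP fx.
set u := wprod ws in r rx Pb Pp *.
have u1 : u <> 1%g.
  rewrite /u; case: (ws) ws0 ch => [//|w2 ws2] _ [[lo2 [c2 [e2 r2]]] _].
  by rewrite wprod_cons; exact: rect_mul_neq1 r2.
have [x1 Gx1 rx1] := represents_supp k w.
have [sx sx1] : SL x /\ SL x1 by split; [case: rx|case: rx1].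
have sg1 := G_supp_SL G1.
have [sb lb eb] := rect_low1 r Pb; have [sp lp ep] := rect_low1 r Pp.
have YP : pihat P Y = translate (g1^-1 * b * x) P.
  have := XP; rewrite (pihat_cons ws0 ch XY XE) => e1.
  by rewrite -mulrA -translateM -e1 translateM mulVr ?SL_unit // translate1.
have Pb2 : P_low u (g1^-1 * b * x1).
  apply: (fibre_point r u1 G1 Pb rx rx1 Gx1).
  apply: (pihat_rank ws0 ch XY); rewrite YP; exists 1; first exact: gen_1.
  by rewrite mulr1.
(* For [Y], the element [b2] replaces [b], and [x1^-1 * x], which represents [u], replaces [x]. *)
set b2 := g1^-1 * b * x1 in Pb2.
have [ux ux1] := (SL_unit sx, SL_unit sx1).
have [ub up] := (SL_unit sb, SL_unit sp).
have ug1 := SL_unit sg1.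
have ub2 : b2 \is a GRing.unit :=  SL_unit (SL_mul (SL_mul (SL_inv sg1) sb) sx1).
have rx2 : represents u (x1^-1 * x).
  by have := represents_mul (represents_inv rx1) rx; rewrite mulKg.
(* Used for [p] and for [p^-1]: the action being a relation, the two inclusions between [X] and its
   image need the equality for [Y] once with each. *)
have fixed q : P_low (w * u)%g q -> P (x^-1 * (b^-1 * q * b) * x) ->
    P_low u (g1^-1 * q * g1) /\ act_point ws (g1^-1 * q * g1) Y = Y.
  move=> Pq fq; have Pq0 : P_low (w * u)%g (b^-1 * q * b).
    by exact: gen_mul (gen_mul (gen_inv Pb) Pq) Pb.
  have [_ l0 e0] := rect_low1 r Pq0.
  have um := conj_upto_mid r rx rx1 l0 e0 fq.
  have qE : g1^-1 * q * g1 = b2 * (x1^-1 * (b^-1 * q * b) * x1) * b2^-1.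
    apply: (canRL (mulrK ub2)).
    by rewrite /b2 !mulrA !(mulrK ug1, mulrK ux1, mulrK ub).
  have Pq2 : P_low u (g1^-1 * q * g1).
    rewrite qE; apply: gen_mul (gen_inv Pb2); apply: gen_mul Pb2 _.
    apply: (rect_low2 r u1) um; apply: gen_mul (rect_G_supp_low1 r Gx1).
    by exact: gen_mul (gen_inv (rect_G_supp_low1 r Gx1)) Pq0.
  split=> //; apply: (IH Y b2 (x1^-1 * x)) => //.
    by rewrite YP /b2 -!mulrA mulVKr // SL_unit.
  rewrite (_ : _ * _ = x^-1 * (b^-1 * q * b) * x) // qE.
  rewrite -(mulrA b2) (mulKr ub2) (mulrVK ub2) invrM ?unitrV // invrK.
  by rewrite !mulrA !(mulrK ux1).
have Ppi : P_low (w * u)%g p^-1 by exact: gen_inv Pp.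
have fxi : P (x^-1 * (b^-1 * p^-1 * b) * x).
  rewrite (_ : _ * _ = (x^-1 * (b^-1 * p * b) * x)^-1); first exact: gen_inv fx.
  by rewrite !invrM ?unitrMl ?unitrV ?SL_unit // !invrK !mulrA.
have [Pp2 Yp2] := fixed p Pp fx; have [Pi2 Yi2] := fixed _ Ppi fxi.
set p2 := g1^-1 * p * g1 in Pp2 Yp2.
have p2i : g1^-1 * p^-1 * g1 = p2^-1.
  by rewrite /p2 !invrM ?unitrMl ?unitrV ?SL_unit // invrK mulrA.
rewrite p2i in Pi2 Yi2.
have sp2 : SL p2 by do 2?apply: SL_mul => //; exact: SL_inv.
have pg1 : p * g1 = g1 * p2 by rewrite /p2 !mulrA mulrV ?SL_unit // mul1r.
have lowQ q : (P_up w `&` G_supp w) q -> P_low u q.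
  by case=> Pq Gq; apply/(rect_up_low2 r u1).
apply/seteqP; split.
  move=> y [z]; rewrite {1}XE => -[q [t [Qq [s Ys st] ->]]].
  move=> /(act_seq_cons _ _ _ _ ws0)[_ [g' [p' [_ [t' [[<- <-] -> [Pp' pq cg tt']]]]]]].
  have G' := proj1 (rect_cell_closure r _) cg.
  have Pq := lowQ q Qq; have [_ Gq] := Qq.
  have [sq sp'] : SL q /\ SL p'.
    by split; [exact: G_supp_SL Gq|have /parabolicP[] := Pp'].
  have qE : g1^-1 * g' = p2 * q * p'^-1.
    have -> : g' = p * (g1 * q) * p'^-1 by rewrite pq mulrK // SL_unit.
    by rewrite (mulrA p) pg1 !mulrA mulVr ?SL_unit // mul1r.
  have Gq'' : G_supp w (g1^-1 * g') by apply: gen_mul G'; exact: gen_inv.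
  (* [g1^-1 * g'] lies in [G_w], and in [P_u] as the product [p2 * q * p'^-1]; by [rect_up_low2] it
     can serve as the new [q]. *)
  rewrite XE; exists (g1^-1 * g'), t'; rewrite mulVKr ?SL_unit //; split=> //.
    split=> //; apply/(rect_up_low2 r u1 Gq''); rewrite qE.
    by apply: gen_mul (gen_inv Pp'); exact: gen_mul.
  move: Ys; rewrite -{1}Yi2 => -[s' Ys' s's]; exists s' => //.
  have := act_seq_comp (act_seq_comp s's st) tt'.
  rewrite qE !invrM ?unitrMl ?unitrV ?SL_unit //.
  by rewrite ?invrK ?mulrA.
move=> y; rewrite {1}XE => -[q [t [Qq [s Ys st] ->]]].
have Pq := lowQ q Qq; have [_ Gq] := Qq; have sq := G_supp_SL Gq.
move: Ys; rewrite -{1}Yp2 => -[s' Ys' s's]; exists (g1 :: s').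
  rewrite XE; exists 1, s'; rewrite mulr1; split=> //; first by split; exact: gen_1.
  by exists s' => //; rewrite invr1; exact: Xhat_refl ch XY Ys'.
(* The factor [q] of the target is absorbed by [p * g1 = g1 * q * (q^-1 * p2)]. *)
apply/(act_seq_cons _ _ _ _ ws0); exists g1, (g1 * q), (q^-1 * p2), s', t.
split=> //; split.
- by apply: gen_mul Pp2; exact: gen_inv Pq.
- by rewrite pg1 -mulrA mulVKr // SL_unit.
- by apply/(rect_cell_closure r); exact: gen_mul.
- exact: act_seq_comp s's st.
Qed.

End Fibres.

(** * The stabiliser of [w_1 x_1] in [G_{w_1}] and its Weyl group *)

Section Stabilisers.
Import GRing.Theory.
Local Open Scope ring_scope.
Local Open Scope classical_set_scope.
Variables (k : closedFieldType) (n : nat) (a : 'I_n).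
Variables (w u : 'S_n.+1) (lo c e : nat).
Hypothesis r : rect a w u lo c e.
Local Notation M := 'M[k]_n.+1.
Local Notation P := (@parabolic k n (~: [set a])%SET).
Implicit Types (g h p q b x : M) (v : 'S_n.+1) (i j y z : 'I_n.+1).
Let mid := (lo + (e - c))%N.

Lemma stab_cosetP g x1 : represents w x1 -> G_supp w g ->
  translate g (wpoint w (P_up w)) = wpoint w (P_up w) <-> upto mid (x1^-1 * g * x1).
Proof.
move=> rx1 Gg; have sx1 : SL x1 by case: rx1.
have sg := G_supp_SL Gg.
rewrite (wpoint_translate _ rx1) translateM translate_parabolic; last exact: SL_mul.
have e1 : (g * x1)^-1 * x1 = (x1^-1 * g * x1)^-1.
  by rewrite !invrM ?unitrMl ?unitrV ?SL_unit // !invrK mulrA.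
have s1 : SL (x1^-1 * g * x1) by apply: SL_mul => //; apply: SL_mul => //; exact: SL_inv.
rewrite e1 -/(P_up w); split=> [/(rect_P_up r)[_ h]|h].
  by rewrite -[X in upto _ X]invrK; apply: upto_inv h; exact: SL_inv.
by apply/(rect_P_up r); split; [exact: SL_inv|exact: upto_inv].
Qed.

Lemma stab_entries g x1 : represents w x1 -> upto mid (x1^-1 * g * x1) <->
  forall y z, (mid <= w y)%N -> (w z < mid)%N -> g y z = 0.
Proof.
move=> rx1; have [f [f0 _ AE EA]] := represents_entries rx1.
split=> [h y z wy wz|h i j jm mi].
  have := h (w y) (w z) wz wy; rewrite AE EA !permK => /eqP.
  by rewrite !mulf_eq0 invr_eq0 !(negbTE (f0 _)) orbF => /eqP.
by rewrite AE EA h ?mulr0 ?mul0r // permKV.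
Qed.

(** Inside [[lo, e)], [w] and [w * u] separate the positions alike, into [[lo, c)] and [[c, e)];
    outside, [g] is the identity. *)
Lemma stab_fixes_wP g x x1 : represents w x1 -> represents (w * u)%g x -> G_supp w g ->
  upto mid (x1^-1 * g * x1) -> P (x^-1 * g * x).
Proof.
move=> rx1 rx Gg /(stab_entries _ rx1) h.
have sx : SL x by case: rx.
have /(fixesP lo e g) fx := rect_fixes r Gg.
apply/maximal_parabolicP; split.
  by apply: SL_mul => //; apply: SL_mul (SL_inv sx) _; exact: G_supp_SL Gg.
have [d [_ _ AE EA]] := represents_entries rx.
move=> i j ja ai; rewrite AE EA; set y := ((w * u)^-1%g i); set z := ((w * u)^-1%g j).
have yE : (w * u)%g y = i by rewrite permKV.
have zE : (w * u)%g z = j by rewrite permKV.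
suff -> : g y z = 0 by rewrite mulr0 mul0r.
case: (boolP (inside lo e y && inside lo e z)) => [|out]; last first.
  rewrite fx //; case: eqP => // yz; move: ja ai; rewrite -yE -zE yz; lia.
rewrite /inside => /andP[yi zi].
have := ht_side a (w * u)%g y; have := ht_side a (w * u)%g z; rewrite yE zE => sz sy.
have [s1 _ _ _] := rect_side1 (rect_h r) z; have [_ s2 _ _] := rect_side1 (rect_h r) y.
apply: h; rewrite ?[(mid <= _)%N]leqNgt (rect_swap_mid r); lia.
Qed.

Lemma represents_inside g v y : represents v g -> G_supp w g ->
  ~~ inside lo e y -> v y = y.
Proof.
move=> rg Gg yo; have [d [_ gE _ _]] := represents_entries rg.
have /(fixesP lo e g)/(_ y y) := rect_fixes r Gg; rewrite (negbTE yo) eqxx gE.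
by case: eqP => // _ /(_ isT) /eqP; rewrite mul0r eq_sym oner_eq0.
Qed.

(** The simple reflections of the Levi subgroup with blocks [[lo, c)] and [[c, e)]: all those in the
    support of [w] except the one across the cut [c]. *)
Definition levi_simple : {set 'I_n} :=
  [set i : 'I_n | (lo <= i)%N && (i.+1 < e)%N && (i.+1 != c)]%SET.

Lemma stab_represents_cut g v x1 y : represents v g -> G_supp w g -> represents w x1 ->
  upto mid (x1^-1 * g * x1) -> (lo <= y < c)%N -> (lo <= v y < c)%N.
Proof.
move=> rg Gg rx1 /(stab_entries _ rx1) h yc.
have [lc ce en] := rect_bounds r.
have [d [d0 gE _ _]] := represents_entries rg.
have vin : inside lo e (v y).
  apply: contraT => vo; have /perm_inj vy := represents_inside rg Gg vo.
  by move: vo; rewrite vy /inside; lia.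
rewrite ltnNge; apply/andP; split; first by case/andP: vin.
apply/negP => cv; have : g y (v y) = 0.
  by apply: h; rewrite ?[(mid <= _)%N]leqNgt (rect_swap_mid r) /inside in vin *; lia.
by rewrite gE eqxx mul1r => /eqP; rewrite (negbTE (d0 _)).
Qed.

(** [stab_represents_cut] for [g] and for [g^-1] shows that [v] preserves [[lo, c)]; as [v] is the
    identity outside the block, it preserves [[c, e)] too. *)
Lemma stab_represents_levi g v x1 : represents v g -> G_supp w g -> represents w x1 ->
  upto mid (x1^-1 * g * x1) -> v \in W_par levi_simple.
Proof.
move=> rg Gg rx1 um; apply/W_parP => l; rewrite inE => lJ y.
have [lc ce en] := rect_bounds r.
have sg := G_supp_SL Gg; have sx1 : SL x1 by case: rx1.
have rgi := represents_inv rg; have Ggi := gen_inv Gg.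
have umi : upto mid (x1^-1 * g^-1 * x1).
  have -> : x1^-1 * g^-1 * x1 = (x1^-1 * g * x1)^-1.
    by rewrite !invrM ?unitrMl ?unitrV ?SL_unit // !invrK mulrA.
  by apply: upto_inv um; apply: SL_mul => //; apply: SL_mul => //; exact: SL_inv.
have out z : ~~ inside lo e z -> v z = z := represents_inside rg Gg.
case: (boolP (inside lo e y)) => yi; last by rewrite out.
have vi : inside lo e (v y).
  by apply: contraT => vo; move: (vo); rewrite (perm_inj (out _ vo)) yi.
have h1 := @stab_represents_cut g v x1 y rg Gg rx1 um.
have h2 := @stab_represents_cut g^-1 v^-1%g x1 (v y) rgi Ggi rx1 umi.
rewrite permK in h2; rewrite /inside in yi vi.
by lia.
Qed.

Lemma levi_cut v (d : nat) y : v \in W_par levi_simple -> (d <= lo)%N || (d == c) || (e <= d)%N ->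
  (v y < d)%N = (y < d)%N.
Proof.
move/W_parP => h hd; have [lc ce en] := rect_bounds r.
case: d hd => // d hd; rewrite !ltnS.
case: (ltnP d n) => dn; last by have := ltn_ord y; have := ltn_ord (v y); lia.
by apply: (h (Ordinal dn)); rewrite inE /=; lia.
Qed.

Lemma levi_stab g v x1 : represents v g -> represents w x1 ->
  v \in W_par levi_simple -> upto mid (x1^-1 * g * x1).
Proof.
move=> rg rx1 vJ; apply/(stab_entries _ rx1) => y z.
have [d [_ gE _ _]] := represents_entries rg; have [lc ce en] := rect_bounds r.
rewrite leqNgt !(rect_swap_mid r) gE => hy hz; case: eqP => [vy|_]; last by rewrite mul0r.
have := levi_cut (d := lo) y vJ; have := levi_cut (d := c) y vJ; have := levi_cut (d := e) y vJ.
rewrite vy !leqnn !eqxx ?orbT => /(_ isT) h1 /(_ isT) h2 /(_ isT) h3; lia.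
Qed.

Lemma levi_represents v : v \in W_par levi_simple ->
  exists2 g : M, G_supp w g & represents v g.
Proof.
case/gen_prodgP => m [f hf ->].
suff [s sub <-] : exists2 s, {subset s <= Supp w} & word_prod s = (\prod_(i < m) f i)%g.
  exact: (G_supp_represents k sub (erefl _)).
elim/big_ind: _ => [|v1 v2 [s1 h1 <-] [s2 h2 <-]|i _].
- by exists [::] => //; rewrite word_nil.
- by exists (s1 ++ s2); [move=> l; rewrite mem_cat => /orP[/h1|/h2]|rewrite word_cat].
have /imsetP[l lJ ->] := hf i; exists [:: l].
  by move=> l'; rewrite inE => /eqP ->; rewrite (rect_Supp r); move: lJ; rewrite inE => /andP[].
by rewrite word_cons word_nil mulg1.
Qed.

End Stabilisers.

(** * Equality of the two stabilisers *)

Section StabilisersXhat.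
Import GRing.Theory.
Local Open Scope ring_scope.
Local Open Scope classical_set_scope.

(** If [g] fixes the point and [ws] is not empty, comparing first terms puts [g1^-1 * g * g1] in the
    stabiliser [P_u] of the remaining product. By [fibre_point] with [b = 1], [g1^-1 * x1] is in
    [P_u] as well, so [x1^-1 * g * x1] respects the flag step [mid]. The converse is [act_fixed]
    with [b = 1]. *)
Lemma stab_Xhat_coset (k : closedFieldType) n (a : 'I_n) (w1 : 'S_n.+1) ws
    (X : set (seq 'M[k]_n.+1)) :
  chain a (w1 :: ws) -> base_point (w1 :: ws) (parabolic (~: [set a])%SET) (wprod (w1 :: ws)) X ->
  stab_Xhat w1 (w1 :: ws) X = stab_coset w1 (wpoint w1 (P_up w1)).
Proof.
move=> ch [hX piX]; have [[lo [c [e r]]] ch'] := ch.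
have [x rx] := represents_exists k (wprod (w1 :: ws)).
have [x1 Gx1 rx1] := represents_supp k w1.
have [sx sx1] : SL x /\ SL x1 by split; [case: rx|case: rx1].
rewrite (wpoint_translate _ rx) in piX.
apply/seteqP; split=> g [Gg hg]; split=> //; last first.
  have um := proj1 (stab_cosetP r rx1 Gg) hg.
  have b1 : P_low (wprod (w1 :: ws)) (1 : 'M[k]_n.+1) by exact: gen_1.
  apply: (act_fixed _ ch hX rx b1); rewrite ?mul1r ?invr1 ?mulr1 ?mul1r //.
    by rewrite wprod_cons; exact: (rect_G_supp_low1 r).
  by rewrite wprod_cons in rx; exact: (stab_fixes_wP r rx1 rx Gg um).
case: (eqVneq ws [::]) => [ws0|/eqP ws0].
  move: r hX hg; rewrite ws0 /wprod big_nil => r [C sC XE] hg.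
  have w1E : wprod [:: w1] = w1 by rewrite /wprod big_seq1.
  have rw1 : represents w1 x by rewrite -w1E -ws0.
  move: piX; rewrite XE pihat_one => piX.
  have [g0 _ [CE _]] := schubert_vanishing r sC.
  have CC : [set g * h | g in C & h in parabolic (~: [set a])%SET] = C.
    apply/seteqP; split=> [_ [y Cy [h Ph <-]]|y Cy]; last first.
      by exists y => //; exists 1; rewrite ?mulr1 //; exact: gen_1.
    move: Cy; rewrite CE => -[h' Ph' <-]; exists (h' * h); rewrite ?mulrA //.
    exact: gen_mul.
  rewrite (wpoint_translate _ rw1) -/(P_up w1) (last_P_up _ r) -piX CC.
  have in1 y : C y <-> X [:: y].
    by rewrite XE; split=> [Cy|[_ Cy [<-]]] //; exists y.
  apply/seteqP; split=> [_ [y /in1 Xy <-]|y /in1].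
    by apply/in1; rewrite -hg; exists [:: y] => //; apply/act_seq_one; exists y.
  rewrite -{1}hg => -[zs Xz /act_seq_one[y' [zE [->]]]]; exists y' => //.
  by apply/in1; rewrite -zE.
have u1 : wprod ws <> 1%g.
  case: (ws) ws0 ch' => [//|w2 ws2] _ [[lo2 [c2 [e2 r2]]] _].
  by rewrite wprod_cons; exact: rect_mul_neq1 r2.
have := hX => /(Xhat_cons _ _ ws0)[g1 [Y [/(rect_cell_closure r) G1 XY XE]]].
have sg1 := G_supp_SL G1.
rewrite wprod_cons in rx.
have YP : pihat (parabolic (~: [set a])%SET) Y = translate (g1^-1 * x) (parabolic (~: [set a])%SET).
  have := piX; rewrite (pihat_cons ws0 ch' XY XE) => e1.
  by rewrite -translateM -e1 translateM mulVr ?SL_unit // translate1.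
have b1 : P_low (w1 * wprod ws)%g (1 : 'M[k]_n.+1) by exact: gen_1.
have Pb2 : P_low (wprod ws) (g1^-1 * 1 * x1).
  apply: (fibre_point r u1 G1 b1 rx rx1 Gx1).
  apply: (pihat_rank ws0 ch' XY); rewrite YP; exists 1; first exact: gen_1.
  by rewrite !mulr1.
rewrite mulr1 in Pb2.
have Yx : pihat (parabolic (~: [set a])%SET) Y (g1^-1 * x).
  by rewrite YP; exists 1; rewrite ?mulr1 //; exact: gen_1.
have [s [_ [Ys _ _]]] := Yx.
have : X (g1 :: s).
  rewrite XE; exists 1, s; rewrite mulr1; split=> //; first by split; exact: gen_1.
  by exists s => //; rewrite invr1; exact: Xhat_refl ch' XY Ys.
rewrite -{1}hg => -[z]; rewrite {1}XE => -[q [t [[Pq Gq] _ ->]]].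
move=> /(act_seq_cons _ _ _ _ ws0)[_ [_ [p' [_ [_ [[<- _] [<- _] [Pp' pq _ _]]]]]]].
have Pq2 : P_low (wprod ws) q by apply/(rect_up_low2 r u1).
have low : P_low (wprod ws) (g1^-1 * g * g1).
  have -> : g1^-1 * g * g1 = p' * q^-1.
    apply: (canRL (mulrK (SL_unit (G_supp_SL Gq)))).
    by rewrite -!mulrA pq mulKr // SL_unit.
  by apply: gen_mul Pp' _; exact: gen_inv.
apply/(stab_cosetP r rx1 Gg); apply: (rect_low2_mid r u1).
have -> : x1^-1 * g * x1 = (g1^-1 * x1)^-1 * (g1^-1 * g * g1) * (g1^-1 * x1).
  rewrite invrM ?unitrV ?SL_unit // invrK !mulrA.
  by rewrite !(mulrK (SL_unit sg1)) // mulrK ?SL_unit.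
exact: gen_mul (gen_mul (gen_inv Pb2) low) Pb2.
Qed.

End StabilisersXhat.

Theorem theorem4p1 (k : closedFieldType) (n : nat) (a : 'I_n) (w : 'S_n.+1)
    (s : seq 'I_n) (ps : seq 'I_(size s))
    (w1 : 'S_n.+1) (ws : seq 'S_n.+1) (xhat : set (seq 'M[k]_n.+1)) :
  W_min (~: [set a])%SET w -> w <> 1%g ->
  reduced_decomposition s w ->
  peak_ordering ps ->
  construction1 ps = w1 :: ws ->
  base_point (w1 :: ws) (parabolic (~: [set a])%SET) w xhat ->
  let T1 := T_supp w1 in
  let stab_xhat := stab_Xhat w1 (w1 :: ws) xhat in
  let stab_w1x1 := stab_coset w1 (wpoint w1 (P_up w1)) in
  weyl_of stab_xhat T1 = weyl_of stab_w1x1 T1 /\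
  exists J : {set 'I_n}, weyl_of stab_w1x1 T1 = [set u | u \in W_par J]%classic.
Proof.
move=> /W_minP gw _ sw pso ce hb T1.
have [ch wE] := construction_chain gw sw pso.
rewrite ce in ch wE; rewrite -wE in hb.
rewrite (stab_Xhat_coset ch hb); split=> //.
have [[lo [c [e r]]] _] := ch.
have [x1 _ rx1] := represents_supp k w1.
exists (levi_simple n lo c e); apply/seteqP; split=> [v [g [[Gg hg] _ rg]]|v /= vJ].
  exact: (stab_represents_levi r rg Gg rx1 (proj1 (stab_cosetP r rx1 Gg) hg)).
have [g Gg rg] := levi_represents k r vJ.
exists g; split=> //; last exact: (normalises_T_supp rg Gg).
by split=> //; apply/(stab_cosetP r rx1 Gg); exact: (levi_stab r rg rx1 vJ).
Qed.
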